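(* Let $p$ be a prime, $\kappa_p(v):=\rho_p\left(\frac12+\frac{v+1}{v-1}\right)$, and consider the involution $I:\ell^2(\mathbb{Z})\to\ell^2(\mathbb{Z})$, $I(\delta_n)=\delta_{-n}$. Then one has $$(1-\mathcal{P})\kappa_p\mathcal{P}=\frac{1-p}{p}\,U_-VIV^*U_+^*=\frac{1-p}{p}\,U_-UBIBU^*U_+^*.$$
   Context: $\rho_p(z):=\dfrac{1-p^{z-1}}{1-p^{-z}}$, of modulus $1$ on $\Re(z)=\frac12$. $L^2(S^1)$ is taken with normalized arc length and $\mathcal{P}$ is the orthogonal projection onto the Hardy space $H^2(\mathcal{U})$ of the unit disk $\mathcal{U}$ (closed span of $z^k$, $k\ge0$); $\kappa_p$ (defined on $S^1\setminus\{1\}$) acts by multiplication. Inner products are antilinear in the first variable. $(\delta_n)$ denotes the canonical orthonormal basis of $\ell^2(\mathbb{Z})$ (resp. $\ell^2(\mathbb{N})$, $\mathbb{N}=\{0,1,2,\dots\}$). For $n\in\mathbb{Z}$ let $x_p(n)=\frac{4\pi n-i\log p}{4\pi n+3i\log p}$ and let $\zeta_n\in\ell^2(\mathbb{N})$ be the vector $\zeta_n(k)=\frac{2^{3/2}(\log p)^{1/2}}{4\pi n+3i\log p}\,x_p(n)^k$. $V:\ell^2(\mathbb{Z})\to\ell^2(\mathbb{N})$ is the bounded linear map with $V(\delta_n)=\zeta_n$. $B:\ell^2(\mathbb{Z})\to\ell^2(\mathbb{Z})$ is the unique positive bounded operator (which is invertible) such that $\langle B(\delta_m)\mid B(\delta_n)\rangle=\frac{1}{2i\pi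 m-2i\pi n+\log p}$ for all $n,m\in\mathbb{Z}$. $U:=VB^{-1}:\ell^2(\mathbb{Z})\to\ell^2(\mathbb{N})$. $U_\pm:\ell^2(\mathbb{N})\to L^2(S^1)$ are the isometries $U_+(\delta_n)=z^n$, $U_-(\delta_n)=z^{-n-1}$, whose ranges are respectively the ranges of $\mathcal{P}$ and $1-\mathcal{P}$. *)

(* Defs.v *)
From HB Require Import structures.
From mathcomp Require Import all_boot all_order all_algebra.
From mathcomp Require Import generic_quotient ring_quotient sesquilinear.
From mathcomp Require Import all_classical all_reals all_analysis.
From mathcomp Require Import complex ring.

Set Implicit Arguments.
Unset Strict Implicit.
Unset Printing Implicit Defensive.
Import Order.TTheory GRing.Theory Num.Theory.
Import numFieldNormedType.Exports.

Local Open Scope classical_set_scope.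
Local Open Scope complex_scope.
Local Open Scope ring_scope.

Section SquareIntegrable.
Context d (T : measurableType d) (R : realType).
Variable mu : {measure set T -> \bar R}.
Implicit Types f g : T -> R[i]^o.

Definition L2pred : {pred (T -> R[i]^o)} :=
  [pred f : T -> R[i]^o | (((fun x : T => complex.Re (f x)) : T -> R) \in Lfun mu 2%:E)
         && (((fun x : T => complex.Im (f x)) : T -> R) \in Lfun mu 2%:E)].

Lemma L2_submod_closed : submod_closed L2pred.
Proof.
have L1 : (1 <= 2%:E :> \bar R)%E by rewrite lee_fin ler1n.
have [L0 LD] := Lfun_submod_closed mu L1.
split; first by apply/andP; split; exact: L0.
move=> a f g /andP[f1 f2] /andP[g1 g2]; apply/andP; split.
  rewrite (_ : (fun _ => _) = complex.Re a *: (fun x => complex.Re (f x)) +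
     (- complex.Im a *: (fun x => complex.Im (f x)) +
      (fun x => complex.Re (g x)))).
    by apply: (LD) => //; apply: (LD).
  apply/funext => x; rewrite !fctE /=.
  by case: a (f x) (g x) => [a b] [u v] [w t] /=; rewrite addrA -mulNr.
rewrite (_ : (fun _ => _) = complex.Re a *: (fun x => complex.Im (f x)) +
   (complex.Im a *: (fun x => complex.Re (f x)) + (fun x => complex.Im (g x)))).
  by apply: (LD) => //; apply: (LD).
apply/funext => x; rewrite !fctE /=.
by case: a (f x) (g x) => [a b] [u v] [w t] /=; rewrite addrA.
Qed.
HB.instance Definition _ := GRing.isSubmodClosed.Build _ _ L2pred
  L2_submod_closed.

Record L2fun := MkL2fun { L2val :> T -> R[i]^o; L2valP : L2val \in L2pred }.
HB.instance Definition _ := [isSub for L2val].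
HB.instance Definition _ := [Choice of L2fun by <:].
HB.instance Definition _ := [SubChoice_isSubLmodule of L2fun by <:].

(* [L2 mu] is the quotient of the square-integrable complex functions by the
   ones vanishing almost everywhere. *)
Definition L2null : {pred L2fun} :=
  [pred f : L2fun | `[< {ae mu, forall x, f x = 0} >]].

Lemma L2null_submod_closed : submod_closed L2null.
Proof.
split; first by apply/asboolP; apply: aeW.
move=> a f g /asboolP f0 /asboolP g0; apply/asboolP.
apply: filterS2 f0 g0 => x f0 g0.
by rewrite -[LHS]/(a *: f x + g x) f0 g0 scaler0 addr0.
Qed.
HB.instance Definition _ := GRing.isSubmodClosed.Build _ _ L2null
  L2null_submod_closed.

Definition L2 : Type := Quotient.quot L2null.
HB.instance Definition _ := Choice.on L2.
HB.instance Definition _ := EqQuotient.on L2.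
HB.instance Definition _ := GRing.Zmodule.on L2.
HB.instance Definition _ := ZmodQuotient.on L2.

Local Open Scope quotient_scope.

Lemma eqL2P (f g : L2fun) :
  reflect {ae mu, forall x, f x = g x} (f == g %[mod L2]).
Proof.
rewrite -Quotient.idealrBE; apply: (iffP (asboolP _)); apply: filterS => x /=.
  by move/eqP; rewrite subr_eq0 => /eqP.
by move=> fg; apply/eqP; rewrite subr_eq0; apply/eqP.
Qed.

Definition L2scale (a : R[i]) : L2 -> L2 := lift_op1 L2 (GRing.scale a).

Lemma pi_L2scale a : {morph \pi_L2 : f / a *: f >-> L2scale a f}.
Proof.
move=> f; unlock L2scale; apply/eqP; rewrite -Quotient.idealrBE -scalerBr.
by apply: rpredZ; rewrite Quotient.idealrBE reprK.
Qed.

Let L2scalerA a b (f : L2) : L2scale a (L2scale b f) = L2scale (a * b) f.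
Proof. by rewrite -[f]reprK -!pi_L2scale scalerA. Qed.
Let L2scale1r : left_id 1 L2scale.
Proof. by move=> f; rewrite -[f]reprK -!pi_L2scale scale1r. Qed.
Let L2scalerDr : right_distributive L2scale +%R.
Proof.
by move=> a f g; rewrite -[f]reprK -[g]reprK -!pi_L2scale -!raddfD /=
  -pi_L2scale scalerDr.
Qed.
Let L2scalerDl (f : L2) : {morph L2scale^~ f : a b / a + b}.
Proof. by move=> a b; rewrite -[f]reprK -!pi_L2scale scalerDl raddfD. Qed.
HB.instance Definition _ := GRing.Zmodule_isLmodule.Build R[i] L2
  L2scalerA L2scale1r L2scalerDr L2scalerDl.

Definition L2fct (f : L2) : T -> R[i] := repr f.
Coercion L2fct : L2 >-> Funclass.

Lemma L2P (f g : L2) : {ae mu, forall x, f x = g x} <-> f = g.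
Proof.
split=> [/eqL2P|-> //]; last exact: aeW.
by rewrite /= !reprK => /eqP.
Qed.

Lemma L2zero : {ae mu, forall x, (0 : L2) x = 0}.
Proof.
suff /eqL2P : repr (0 : L2) == 0 %[mod L2] by [].
by rewrite reprK raddf0.
Qed.

Lemma L2ZDE a (f g : L2) : {ae mu, forall x, (a *: f + g : L2) x = a * f x + g x}.
Proof.
suff /eqL2P : repr (a *: f + g) == a *: repr f + repr g %[mod L2] by [].
by rewrite reprK raddfD /= [\pi_L2 (a *: _)]pi_L2scale !reprK.
Qed.

Definition Cintegrable (h : T -> R[i]) :=
  mu.-integrable setT (EFin \o (fun x => complex.Re (h x))) /\
  mu.-integrable setT (EFin \o (fun x => complex.Im (h x))).

Definition Cintegral (h : T -> R[i]) : R[i] :=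
  (\int[mu]_x complex.Re (h x)) +i* (\int[mu]_x complex.Im (h x)).

Lemma CintegralZD a (h k : T -> R[i]) : Cintegrable h -> Cintegrable k ->
  Cintegral (fun x => a * h x + k x) = a * Cintegral h + Cintegral k.
Proof.
move=> [h1 h2] [k1 k2]; have mT := @measurableT _ T.
have ZI c (u : T -> R) : mu.-integrable setT (EFin \o u) ->
  mu.-integrable setT (EFin \o (fun x => c * u x)).
  by move=> iu; apply: eq_integrable (integrableZl mT c iu).
case: a => a b; rewrite /Cintegral; apply/eqP; rewrite eq_complex /=.
rewrite -!RintegralZl// -RintegralB ?ZI// -!RintegralD ?ZI//.
- apply/andP; split; apply/eqP; apply: eq_Rintegral => x _.
    by case: (h x) (k x) => [u v] [w t].
  by case: (h x) (k x) => [u v] [w t].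
- by apply: eq_integrable (integrableD mT (ZI a _ h2) (ZI b _ h1)).
- by apply: eq_integrable (integrableB mT (ZI a _ h1) (ZI b _ h2)).
Qed.

Lemma CintegrableZD a (h k : T -> R[i]) : Cintegrable h -> Cintegrable k ->
  Cintegrable (fun x => a * h x + k x).
Proof.
move=> [h1 h2] [k1 k2]; have mT := @measurableT _ T.
have ZI c (u : T -> R) : mu.-integrable setT (EFin \o u) ->
  mu.-integrable setT (EFin \o (fun x => c * u x)).
  by move=> iu; apply: eq_integrable (integrableZl mT c iu).
case: a => a b; split.
  apply: eq_integrable (integrableD mT
    (integrableB mT (ZI a _ h1) (ZI b _ h2)) k1) => // x _ /=.
  by case: (h x) (k x) => [u v] [w t].
apply: eq_integrable (integrableD mT
  (integrableD mT (ZI a _ h2) (ZI b _ h1)) k2) => // x _ /=.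
by case: (h x) (k x) => [u v] [w t].
Qed.

Lemma Cintegral_conj (h : T -> R[i]) : Cintegrable h ->
  Cintegral (fun x => (h x)^*) = (Cintegral h)^*.
Proof.
move=> [h1 h2]; apply/eqP; rewrite eq_complex /=; apply/andP; split.
  by apply/eqP; apply: eq_Rintegral => x _; case: (h x).
rewrite -mulN1r -RintegralZl//.
by apply/eqP; apply: eq_Rintegral => x _; case: (h x) => u v /=; rewrite mulN1r.
Qed.

Lemma Cintegrable_dot (f g : L2) : Cintegrable (fun x => f x * (g x)^*).
Proof.
have mT := @measurableT _ T.
have /andP[/= f1 f2] := L2valP (repr f); have /andP[/= g1 g2] := L2valP (repr g).
have I (u v : T -> R) : u \in Lfun mu 2%:E -> v \in Lfun mu 2%:E ->
    mu.-integrable setT (EFin \o (u \* v)).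
  by move=> u2 v2; apply/Lfun1_integrable/Lfun2_mul_Lfun1.
split.
  apply: eq_integrable (integrableD mT (I _ _ f1 g1) (I _ _ f2 g2)) => // x _ /=.
  by rewrite /L2fct; case: (repr f x) (repr g x) => [a b] [u v] /=; rewrite mulrN opprK.
apply: eq_integrable (integrableB mT (I _ _ f2 g1) (I _ _ f1 g2)) => // x _ /=.
by rewrite /L2fct; case: (repr f x) (repr g x) => [a b] [u v] /=; rewrite mulrN addrC.
Qed.

Lemma ae_Cintegral (h k : T -> R[i]) : Cintegrable h -> Cintegrable k ->
  {ae mu, forall x, h x = k x} -> Cintegral h = Cintegral k.
Proof.
move=> [/measurable_int h1 /measurable_int h2].
move=> [/measurable_int k1 /measurable_int k2] hk.
congr (_ +i* _); rewrite /Rintegral; congr fine; apply: ae_eq_integral => //.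
  by apply: filterS hk => x /= ->.
by apply: filterS hk => x /= ->.
Qed.

(* As for all forms of sesquilinear.v, linear in the first argument and
   antilinear in the second; see [inner] for the opposite convention. *)
Definition L2dot (f g : L2) : R[i] := Cintegral (fun x => f x * (g x)^*).

Lemma L2dotC (f g : L2) : L2dot f g = (L2dot g f)^*.
Proof.
rewrite /L2dot -Cintegral_conj; last exact: Cintegrable_dot.
by congr Cintegral; apply/funext => x; rewrite rmorphM /= conjCK mulrC.
Qed.

Lemma L2dot_linearl (g : L2) : scalar (L2dot^~ g).
Proof.
move=> a f f' /=; rewrite -CintegralZD; try exact: Cintegrable_dot.
apply: ae_Cintegral; first exact: Cintegrable_dot.
  by apply: CintegrableZD; exact: Cintegrable_dot.
by apply: filterS (L2ZDE a f f') => x /= ->; rewrite mulrDl mulrA.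
Qed.

Lemma L2dot_linearr (f : L2) : linear_for (Num.conj \; *%R) (L2dot f).
Proof.
by move=> a g g'; rewrite L2dotC L2dot_linearl rmorphD rmorphM /= -!L2dotC.
Qed.

Lemma L2dot_gt0 (f : L2) : f != 0 -> 0 < L2dot f f.
Proof.
have ReE x : complex.Re (f x * (f x)^*) = `|complex.Re (f x * (f x)^*)|.
  case: (f x) => a b /=; rewrite mulrN opprK ger0_norm//.
  by rewrite addr_ge0// -expr2 sqr_ge0.
have [i1 i2] := Cintegrable_dot f f.
have Im0 : complex.Im (L2dot f f) = 0.
  rewrite /= -[RHS](mul0r (\int[mu]_x complex.Re (f x * (f x)^*))) -RintegralZl//.
  by apply: eq_Rintegral => x _; case: (f x) => a b /=; rewrite mulrN mulrC addNr ?mul0r.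
have Re0 : 0 <= complex.Re (L2dot f f).
  by apply: Rintegral_ge0 => x _; rewrite ReE.
move=> f0; rewrite ltcE Im0 eqxx /= lt_neqAle Re0 andbT eq_sym.
apply: contra_neq f0 => /= I0; apply/L2P.
have [+ _] := ae_eq_integral_abs mu measurableT (measurable_int _ i1).
pose h x := complex.Re (f x * (f x)^*).
have -> : (\int[mu]_x `|(EFin \o h) x| = 0)%E.
  rewrite -[RHS](congr1 EFin I0) /L2dot /= /Rintegral fineK; last first.
    exact: integrable_fin_num.
  by apply: eq_integral => x _ /=; rewrite -ReE.
move=> /(_ erefl); apply: filterS2 L2zero => x f0 /(_ I) /= [] h0.
rewrite f0; apply/eqP; rewrite -mul_conjC_eq0 eq_complex h0 eqxx /=.
by case: (f x) => a b /=; rewrite mulrN mulrC addNr ?mul0r.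
Qed.

HB.instance Definition _ := @bilinear_isBilinear.Build R[i] L2 L2 R[i]
  *%R (Num.conj \; *%R) L2dot (L2dot_linearl, L2dot_linearr).

Let L2dot_hermitian (f g : L2) : L2dot f g = (-1) ^+ false * (L2dot g f)^*.
Proof. by rewrite mul1r L2dotC. Qed.
HB.instance Definition _ := @isHermitianSesquilinear.Build R[i] L2 false
  Num.conj L2dot L2dot_hermitian.
HB.instance Definition _ := @isDotProduct.Build R[i] L2 L2dot L2dot_gt0.

End SquareIntegrable.

Section DotNorm.
Variables (C : numClosedFieldType) (U : lmodType C).
Variable form : {dot U for Num.conj}.

Lemma dot_CauchySchwarz (u v : U) :
  `|form u v| <= sqrtC (form u u) * sqrtC (form v v).
Proof.
have [->|v0] := eqVneq v 0.
  by rewrite !linear0r normr0 sqrtC0 mulr0.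
have vv0 : 0 < form v v by rewrite dnorm_gt0.
rewrite -sqrtCM ?nnegrE ?dnorm_ge0// -(sqrCK (normr_ge0 _)).
rewrite ler_sqrtC ?nnegrE ?mulr_ge0 ?exprn_ge0 ?dnorm_ge0//.
have := dnorm_ge0 form (form v v *: u - form u v *: v).
have zl a (w w' : U) : form (a *: w) w' = a * form w w' by rewrite linearZl_LR.
have zr a (w w' : U) : form w (a *: w') = a^* * form w w' by rewrite linearZr_LR.
have vvJ : (form v v)^* = form v v by rewrite conj_Creal ?ger0_real ?ltW.
have uvJ : form v u = (form u v)^* by rewrite (hermC form) expr0 mul1r.
rewrite dnormB !zl !zr vvJ !rmorphM /= !conjCK vvJ -uvJ.
have -> : form v v * (form v v * form u u) + form u v * (form v u * form v v) -
    (form v v * (form v u * form u v) + form v v * (form u v * form v u)) =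
    form v v * (form u u * form v v - form u v * form v u) by ring.
by rewrite pmulr_rge0// subr_ge0 normCK uvJ.
Qed.

Lemma dot_triangle (u v : U) :
  sqrtC (form (u + v) (u + v)) <= sqrtC (form u u) + sqrtC (form v v).
Proof.
rewrite -[leRHS]sqrCK ?addr_ge0 ?sqrt_dnorm_ge0//.
rewrite ler_sqrtC ?nnegrE ?exprn_ge0 ?addr_ge0 ?sqrt_dnorm_ge0 ?dnorm_ge0//.
rewrite dnormD sqrrD !sqrtCK [leRHS]addrAC lerD2l.
apply: (le_trans (y := `|form u v| *+ 2)); last by rewrite ler_wMn2r// dot_CauchySchwarz.
have dR : form u v + (form u v)^* \is Num.real.
  by rewrite CrealE rmorphD /= conjCK addrC.
apply: le_trans (real_ler_norm dR) _.
by rewrite (le_trans (ler_normD _ _))// norm_conjC.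
Qed.
End DotNorm.

Section L2normed.
Context d (T : measurableType d) (R : realType) (mu : {measure set T -> \bar R}).

Let L2norm (f : L2 mu) := sqrtC (L2dot f f).

Let L2normZ a (f : L2 mu) : L2norm (a *: f) = `|a| * L2norm f.
Proof. by rewrite /L2norm dnormZ sqrtCM ?nnegrE ?exprn_ge0 ?dnorm_ge0// sqrCK. Qed.
Let L2norm_eq0 (f : L2 mu) : L2norm f = 0 -> f = 0.
Proof. by move=> /eqP; rewrite sqrt_dnorm_eq0 => /eqP. Qed.

HB.instance Definition _ := @Lmodule_isNormed.Build R[i] (L2 mu) L2norm
  (@dot_triangle _ _ (@L2dot _ _ _ mu)) L2normZ L2norm_eq0.
End L2normed.

Section Operators.
Context d (T : measurableType d) d' (T' : measurableType d') (R : realType).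
Variables (mu : {measure set T -> \bar R}) (nu : {measure set T' -> \bar R}).

(* The class of [f] if [f] is square-integrable, and 0 otherwise. *)
Definition toL2 (f : T -> R[i]) : L2 mu := (\pi_(L2 mu) (insubd 0 f))%qT.

Lemma toL2E (f : T -> R[i]) : f \in L2pred mu ->
  {ae mu, forall x, toL2 f x = f x}.
Proof.
move=> fL2; suff /eqL2P : (repr (toL2 f) == insubd 0 f %[mod L2 mu])%qT.
  by apply: filterS => x; rewrite /L2fct => ->; rewrite -[L2val _]/(val _) insubdK.
by rewrite reprK.
Qed.

Definition L2mul (k : T -> R[i]) (f : L2 mu) : L2 mu :=
  toL2 (fun x => k x * f x).

(* Antilinear in the first argument. *)
Definition inner (f g : L2 mu) : R[i] := L2dot g f.

Definition bounded_op (A : L2 mu -> L2 nu) :=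
  exists M : R, forall f, `|A f| <= M%:C * `|f|.

Definition positive_op (A : L2 mu -> L2 mu) := forall f, 0 <= inner f (A f).

Definition orthoproj_on (W : set (L2 mu)) (P : L2 mu -> L2 mu) :=
  forall f, W (P f) /\ forall g, W g -> inner g (f - P f) = 0.

End Operators.

Definition adjoint d (T : measurableType d) d' (T' : measurableType d')
    (R : realType) (mu : {measure set T -> \bar R})
    (nu : {measure set T' -> \bar R})
    (A : L2 mu -> L2 nu) (A' : L2 nu -> L2 mu) :=
  forall f g, inner (A f) g = inner f (A' g).

HB.instance Definition _ := isPointed.Build int 0.
HB.instance Definition _ := @isMeasurable.Build default_measure_display int
  discrete_measurable discrete_measurable0 discrete_measurableC
  discrete_measurableU.

(* For [I] discrete, such as nat and int: the only negligible set of [counting]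
   is the empty one, so these are the square-summable families indexed by [I]. *)
Definition ell2 d (I : measurableType d) (R : realType) :=
  L2 (@counting I R).

Definition delta d (I : measurableType d) (R : realType) (n : I) : ell2 I R :=
  toL2 (@counting I R) (fun k => (k == n)%:R).

Section Circle.
Variable R : realType.

Definition circle := {z : R[i] | `|z| == 1}.

Definition expi (t : R) : R[i] := cos t +i* sin t.

Lemma norm_expi t : `|expi t| == 1.
Proof. by rewrite normc_def /= cos2Dsin2 sqrtr1. Qed.

Definition cis (t : R) : circle := exist _ (expi (2 * pi * t)) (norm_expi _).

HB.instance Definition _ := Choice.on circle.
HB.instance Definition _ := isPointed.Build circle (cis 0).

(* [cis] is a continuous surjection whose restriction to [0, 1[ is a Borel
   isomorphism, hence these are the Borel sets of the circle. *)
Definition circle_measurable : set (set circle) :=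
  [set A | measurable (cis @^-1` A : set (measurableTypeR R))].

Let circle_measurable0 : circle_measurable set0.
Proof. by rewrite /circle_measurable /= preimage_set0. Qed.
Let circle_measurableC A : circle_measurable A -> circle_measurable (~` A).
Proof.
by move=> mA; rewrite /circle_measurable /= preimage_setC; exact: measurableC.
Qed.
Let circle_measurableU (F : (set circle)^nat) :
  (forall i, circle_measurable (F i)) -> circle_measurable (\bigcup_i F i).
Proof.
by move=> mF; rewrite /circle_measurable /= preimage_bigcup;
  apply: bigcup_measurable => i _; exact: mF.
Qed.
HB.instance Definition _ := @isMeasurable.Build default_measure_display circle
  circle_measurable circle_measurable0 circle_measurableC circle_measurableU.

Lemma measurable_cis :
  measurable_fun setT (cis : measurableTypeR R -> circle).
Proof. by move=> _ A mA; rewrite setTI. Qed.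

Definition arclength : set circle -> \bar R :=
  pushforward (mrestr (@lebesgue_measure R) (measurable_itv `[0%R, 1%R[)) cis.
HB.instance Definition _ := Measure.copy arclength
  (measure_function_pushforward__canonical__measure_function_Measure
    (mrestr (@lebesgue_measure R) (measurable_itv `[0%R, 1%R[)) measurable_cis).

Definition L2S1 := L2 arclength.

Definition zpow (n : int) : L2S1 := toL2 arclength (fun z => val z ^ n).

Definition hardy : set L2S1 :=
  closure [set f | exists n, exists c : 'I_n -> R[i],
                   f = \sum_(k < n) c k *: zpow k%:Z].
End Circle.

Section Kappa.
Variables (R : realType) (p : nat).
Local Notation logp := (ln (p%:R : R)).

Definition cexp (z : R[i]) : R[i] :=
  (expR (complex.Re z))%:C * expi (complex.Im z).

(* p ^ z *)
Definition cpow (z : R[i]) : R[i] := cexp (z * logp%:C).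

Definition rho (z : R[i]) : R[i] := (1 - cpow (z - 1)) / (1 - cpow (- z)).

(* At [v = 1], where the formula is undefined, [0^-1 = 0] gives the junk value
   [rho 2^-1]; this point is negligible. *)
Definition kappa (v : circle R) : R[i] :=
  rho (2^-1 + (val v + 1) / (val v - 1)).

Definition xp (n : int) : R[i] :=
  (4 * pi%:C * n%:~R - 'i * logp%:C) / (4 * pi%:C * n%:~R + 3 * 'i * logp%:C).

Definition zeta (n : int) : ell2 nat R :=
  toL2 _ (fun k : nat =>
    (2 `^ (3 / 2) * logp `^ (1 / 2))%:C / (4 * pi%:C * n%:~R + 3 * 'i * logp%:C)
    * xp n ^+ k).

End Kappa.

(* Main.v *)
Require Import Defs.
From mathcomp Require Import all_boot all_order all_algebra.
From mathcomp Require Import sesquilinear.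
From mathcomp Require Import all_classical all_reals all_analysis.
From mathcomp Require Import complex ring lra zify measurable_realfun.
From mathcomp Require finmap.

(** Write [z = 1/2 + (v + 1) / (v - 1)], which is on the line [Re z = 1/2] when
    [v] is on the circle, [q = p ^ ((v + 1) / (v - 1))] and [a = p^(-1/2)]. Then
<<
      kappa_p = (1 - a q) / (1 - a / q) = - a q + (1 - 1/p) / (1 - p^(-z)).
>>
    The function [q] is inner, so multiplication by it preserves the Hardy space
    and disappears under [1 - P] ([hardy_mul_inner_fun]: [q] is the bounded limit
    of powers of Moebius functions). What remains is determined by the poles of
    [1 / (1 - p^(-z))], the points [z = 2 i pi n / log p], which are [v = x_p(n)]
    in the disk. The classical expansion of [1 / (1 - e^(-u))] in partial
    fractions ([partial_fractions], obtained from an exact identity over roots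
    of unity by Tannery's theorem) becomes, in the variable [v],
<<
      1 / (1 - p^(-z)) = constant + sum_n zeta_n(0)^2 / (v - x_p(n))
>>
    at every [v] other than 1 ([pole_fraction], [ccvg_pole_sum]).

    On the other side, [U_- zeta_n] is the function [zeta_n(0) / (v - x_p(n))]
    ([Um_zeta]), while [V^* delta_k] has the coordinates [conj (zeta_n(k))], and
    [conj (zeta_(-n)(k)) = - zeta_n(k)]. Hence [U_- V I V^* delta_k] is the sum
    of [- zeta_n(0)^2 x_p(n)^k / (v - x_p(n))], convergent in the mean because
    [V] is bounded ([cvgL2_pole_series]). For [k = 0] the mean limit and the
    pointwise limit coincide by Fatou's lemma ([cvgL2_ae_unique]). Multiplying by
    [v^k] changes each [x_p(n)^k / (v - x_p(n))] by a polynomial, which [1 - P]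
    kills, and as [(1 - p) / p = - (1 - 1/p)] the first identity holds on every
    [v^k] ([hankel_monomial]). It extends to the Hardy space by continuity, and
    to [L2] because both sides factor through [P].

    The second identity is formal: [U B = V], and [B U^* = V^*] because a
    positive operator is self-adjoint ([positive_selfadjoint]). *)

Set Implicit Arguments.
Unset Strict Implicit.
Unset Printing Implicit Defensive.
Import Order.TTheory GRing.Theory Num.Theory.
Import numFieldNormedType.Exports.
Local Open Scope classical_set_scope.
Local Open Scope complex_scope.
Local Open Scope ring_scope.

(** * Complex sequences and the complex exponential *)

Section ComplexSequences.
Variable R : realType.
Implicit Types (u v : nat -> R[i]) (z w l m : R[i]).
Notation normc := Normc.normc.

(** Convergence of complex sequences is componentwise, so that all its rules
    reduce to those of real sequences. *)
Definition ccvg (u : nat -> R[i]) (l : R[i]) : Prop :=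
  ((fun n => complex.Re (u n)) @ \oo --> (complex.Re l : R)) /\
  ((fun n => complex.Im (u n)) @ \oo --> (complex.Im l : R)).

Lemma complex_ReM z w : complex.Re (z * w) =
  complex.Re z * complex.Re w - complex.Im z * complex.Im w.
Proof. by case: z w => [a b] [c d]. Qed.

Lemma complex_ImM z w : complex.Im (z * w) =
  complex.Re z * complex.Im w + complex.Im z * complex.Re w.
Proof. by case: z w => [a b] [c d]. Qed.

Lemma complex_ReV z : complex.Re z^-1 =
  complex.Re z / (complex.Re z ^+ 2 + complex.Im z ^+ 2).
Proof. by case: z. Qed.

Lemma complex_ImV z : complex.Im z^-1 =
  - (complex.Im z / (complex.Re z ^+ 2 + complex.Im z ^+ 2)).
Proof. by case: z. Qed.

Lemma normc_sqr z : normc z ^+ 2 = complex.Re z ^+ 2 + complex.Im z ^+ 2.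
Proof. by case: z => a b /=; rewrite sqr_sqrtr// addr_ge0// sqr_ge0. Qed.

Lemma normc_ge0 z : 0 <= normc z.
Proof. by case: z => a b; exact: sqrtr_ge0. Qed.

Lemma normc_triangle z w : normc (z + w) <= normc z + normc w.
Proof. exact: le_normcD. Qed.

Lemma normcN z : normc (- z) = normc z.
Proof. by case: z => x y /=; rewrite !sqrrN. Qed.

Lemma normc_neq0 z : (normc z != 0) = (z != 0).
Proof.
congr negb; apply/eqP/eqP => [/Normc.eq0_normc //|->]; exact: Normc.normc0.
Qed.

Lemma ler_Re_normc z : `|complex.Re z| <= normc z.
Proof.
case: z => a b /=; rewrite -sqrtr_sqr ler_wsqrtr// lerDl sqr_ge0//.
Qed.

Lemma ler_Im_normc z : `|complex.Im z| <= normc z.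
Proof.
case: z => a b /=; rewrite -sqrtr_sqr ler_wsqrtr// lerDr sqr_ge0//.
Qed.

Lemma ccvg_cst l : ccvg (fun=> l) l.
Proof. by split; exact: cvg_cst. Qed.

Lemma ccvgD u v l m : ccvg u l -> ccvg v m -> ccvg (fun n => u n + v n) (l + m).
Proof.
move=> [u1 u2] [v1 v2]; split; rewrite raddfD/=; under eq_fun do rewrite raddfD/=;
  exact: cvgD.
Qed.

Lemma ccvgN u l : ccvg u l -> ccvg (fun n => - u n) (- l).
Proof.
move=> [u1 u2]; split; rewrite raddfN/=; under eq_fun do rewrite raddfN/=;
  exact: cvgN.
Qed.

Lemma ccvgB u v l m : ccvg u l -> ccvg v m -> ccvg (fun n => u n - v n) (l - m).
Proof. by move=> ul vm; apply: ccvgD => //; exact: ccvgN. Qed.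

Lemma ccvgM u v l m : ccvg u l -> ccvg v m -> ccvg (fun n => u n * v n) (l * m).
Proof.
move=> [u1 u2] [v1 v2]; split.
  rewrite complex_ReM; under eq_fun do rewrite complex_ReM.
  by apply: cvgB; exact: cvgM.
rewrite complex_ImM; under eq_fun do rewrite complex_ImM.
by apply: cvgD; exact: cvgM.
Qed.

Lemma ccvgV u l : l != 0 -> ccvg u l -> ccvg (fun n => (u n)^-1) l^-1.
Proof.
move=> l0 [u1 u2].
have n0 : complex.Re l ^+ 2 + complex.Im l ^+ 2 != 0.
  by rewrite -normc_sqr sqrf_eq0 normc_neq0.
have h : (fun n => (complex.Re (u n) ^+ 2 + complex.Im (u n) ^+ 2)^-1) @ \oo
    --> ((complex.Re l ^+ 2 + complex.Im l ^+ 2)^-1 : R).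
  by apply: cvgV => //; apply: cvgD; rewrite expr2; under eq_fun do rewrite expr2; apply: cvgM.
split.
  rewrite complex_ReV; under eq_fun do rewrite complex_ReV.
  by apply: cvgM.
rewrite complex_ImV; under eq_fun do rewrite complex_ImV.
by apply: cvgN; apply: cvgM.
Qed.

Lemma ccvg_normc u l : ccvg u l -> (fun n => normc (u n)) @ \oo --> (normc l : R).
Proof.
move=> [u1 u2].
have E z : normc z = Num.sqrt (complex.Re z * complex.Re z + complex.Im z * complex.Im z).
  by case: z.
rewrite E; under eq_fun do rewrite E.
have H : (fun n => complex.Re (u n) * complex.Re (u n) + complex.Im (u n) * complex.Im (u n))
    @ \oo --> (complex.Re l * complex.Re l + complex.Im l * complex.Im l : R).
  by apply: cvgD; exact: cvgM.
by apply: (cvg_comp _ _ H); exact: sqrt_continuous.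
Qed.

Lemma ccvg_dist u l : (fun n => normc (u n - l)) @ \oo --> (0 : R) <-> ccvg u l.
Proof.
split=> [h|ul]; last first.
  rewrite -(Normc.normc0 R) -[X in normc X](subrr l); apply: ccvg_normc.
  by apply: ccvgB => //; exact: ccvg_cst.
split; apply/cvgrPdist_lt => e e0; near=> n.
  rewrite distrC -raddfB; apply: le_lt_trans (ler_Re_normc _) _.
  rewrite -[X in X < _]ger0_norm ?normc_ge0//; near: n.
  by apply: cvgr0_norm_lt h _ e0.
rewrite distrC -raddfB; apply: le_lt_trans (ler_Im_normc _) _.
rewrite -[X in X < _]ger0_norm ?normc_ge0//; near: n.
by apply: cvgr0_norm_lt h _ e0.
Unshelve. all: by end_near. Qed.

Lemma ccvg_real (a : nat -> R) (b : R) : a @ \oo --> b ->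
  ccvg (fun n => (a n)%:C) b%:C.
Proof. by move=> ab; split => //=; exact: cvg_cst. Qed.

Lemma cexpD z w : cexp (z + w) = cexp z * cexp w :> R[i].
Proof.
case: z w => [a b] [c d]; apply/eqP; rewrite eq_complex /cexp /expi /=.
rewrite expRD cosD sinD; apply/andP; split; apply/eqP; ring.
Qed.

Lemma cexp0 : cexp 0 = 1 :> R[i].
Proof. by rewrite /cexp /expi /= expR0 cos0 sin0 mul1r. Qed.

Lemma cexpMn z n : cexp (n%:R * z) = cexp z ^+ n :> R[i].
Proof.
elim: n => [|n IH]; first by rewrite mul0r cexp0.
by rewrite -natr1 mulrDl mul1r cexpD IH exprSr.
Qed.

Lemma normc_expi (t : R) : normc (expi t) = 1.
Proof. by rewrite /= cos2Dsin2 sqrtr1. Qed.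

Lemma normc_cexp z : normc (cexp z) = expR (complex.Re z).
Proof.
rewrite Normc.normcM normc_expi mulr1 /= expr0n/= addr0 sqrtr_sqr ger0_norm//.
Qed.

Lemma cexp_neq0 z : cexp z != 0 :> R[i].
Proof. by rewrite -normc_neq0 normc_cexp gt_eqF// expR_gt0. Qed.

Lemma cexpN z : cexp (- z) = (cexp z)^-1 :> R[i].
Proof. by apply: (mulfI (cexp_neq0 z)); rewrite -cexpD subrr cexp0 divff// cexp_neq0. Qed.

Lemma derive_sequence (f : R -> R) (df : R) : is_derive (0 : R) 1 f df ->
  (fun n => n.+1%:R * (f n.+1%:R^-1 - f 0)) @ \oo --> (df : R).
Proof.
move=> [fd <-].
have h0 : (fun n : nat => (n.+1%:R^-1 : R)) @ \oo --> (0 : R)^'.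
  move=> A A0.
  have A1 : \forall n \near \oo, (fun t : R => t != 0 -> A t) n.+1%:R^-1.
    exact: (@cvg_harmonic R _ A0).
  change (\forall n \near \oo, A (n.+1%:R^-1)).
  by apply: filterS A1 => n; apply; rewrite invr_eq0 pnatr_eq0.
have := cvg_comp _ _ h0 fd; apply: cvg_trans; apply: near_eq_cvg.
by apply: nearW => n /=; rewrite invrK addr0 -[_ *: 1]/(_ * 1) mulr1.
Qed.

Lemma is_derive_scale0 (a : R) : is_derive (0 : R) 1 (fun t => a * t) a.
Proof. by apply: is_derive_eq; rewrite -[_ *: _]/(_ * _) mulr1. Qed.

Lemma real_complex_nat n : n%:R = (n%:R)%:C :> R[i].
Proof. by rewrite rmorph_nat. Qed.

Lemma complex_ReZ (a : R) z : complex.Re (a%:C * z) = a * complex.Re z.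
Proof. by rewrite complex_ReM /= mul0r subr0. Qed.

Lemma complex_ImZ (a : R) z : complex.Im (a%:C * z) = a * complex.Im z.
Proof. by rewrite complex_ImM /= mul0r addr0. Qed.

(** The derivative of the exponential at 0, along the steps [1 / n]. It drives
    both limits of this development: from trigonometric to rational partial
    fractions, and from Moebius functions to the inner function. *)
Lemma ccvg_cexp_derivative z :
  ccvg (fun n => n.+1%:R * (cexp (n.+1%:R^-1 * z) - 1)) z.
Proof.
have E n : n.+1%:R^-1 = (n.+1%:R^-1)%:C :> R[i] by rewrite real_complex_nat fmorphV.
have Ec n : complex.Re (n.+1%:R * (cexp (n.+1%:R^-1 * z) - 1)) =
    n.+1%:R * (expR (complex.Re z * n.+1%:R^-1) * cos (complex.Im z * n.+1%:R^-1)
     - expR (complex.Re z * 0) * cos (complex.Im z * 0)).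
  rewrite E (real_complex_nat n.+1) complex_ReZ raddfB/= /cexp.
  rewrite !complex_ReZ !complex_ImZ /= !mulr0 expR0 cos0 mulr1.
  by rewrite ![_^-1 * _]mulrC mul0r subr0.
have Es n : complex.Im (n.+1%:R * (cexp (n.+1%:R^-1 * z) - 1)) =
    n.+1%:R * (expR (complex.Re z * n.+1%:R^-1) * sin (complex.Im z * n.+1%:R^-1)
     - expR (complex.Re z * 0) * sin (complex.Im z * 0)).
  rewrite E (real_complex_nat n.+1) complex_ImZ raddfB/= /cexp.
  rewrite !complex_ReZ !complex_ImZ /= !mulr0 sin0 mulr0.
  by rewrite ![_^-1 * _]mulrC mul0r addr0 subr0.
have De : is_derive (0 : R) 1 (fun t => expR (complex.Re z * t)) (complex.Re z).
  apply: (is_derive_eq (is_derive1_comp (is_derive_expR _) (is_derive_scale0 _))).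
  by rewrite mulr0 expR0 mul1r.
have Dc : is_derive (0 : R) 1 (fun t => cos (complex.Im z * t)) 0.
  apply: (is_derive_eq (is_derive1_comp (is_derive_cos _) (is_derive_scale0 _))).
  by rewrite mulr0 sin0 oppr0 mul0r.
have Ds : is_derive (0 : R) 1 (fun t => sin (complex.Im z * t)) (complex.Im z).
  apply: (is_derive_eq (is_derive1_comp (is_derive_sin _) (is_derive_scale0 _))).
  by rewrite mulr0 cos0 mul1r.
split.
  under eq_fun do rewrite Ec.
  apply: (derive_sequence (f := fun t => expR (complex.Re z * t) * cos (complex.Im z * t))).
  apply: is_derive_eq (is_deriveM De Dc) _.
  by rewrite !mulr0 expR0 cos0 scaler0 add0r -[_ *: _]/(_ * _) mul1r.
under eq_fun do rewrite Es.
apply: (derive_sequence (f := fun t => expR (complex.Re z * t) * sin (complex.Im z * t))).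
apply: is_derive_eq (is_deriveM De Ds) _.
by rewrite !mulr0 expR0 sin0 -![_ *: _]/(_ * _) mul0r addr0 mul1r.
Qed.
End ComplexSequences.

(** * Partial fractions of [1 / (1 - e^-u)] *)

Section FiniteSums.

Lemma sum_symmetric (V : zmodType) (F : int -> V) (N : nat) :
  \sum_(k < N.*2.+1) F (k%:Z - N%:Z) =
  F 0 + \sum_(n < N) (F n.+1%:Z + F (- n.+1%:Z)).
Proof.
elim: N => [|N IH]; first by rewrite !big_ord_recl !big_ord0 subrr.
rewrite doubleS big_ord_recl big_ord_recr /=.
have -> : \sum_(i < N.*2.+1) F ((lift ord0 (widen_ord (leqnSn N.*2.+1) i))%:Z - N.+1%:Z)
   = \sum_(k < N.*2.+1) F (k%:Z - N%:Z).
  apply: eq_bigr => k _; congr F; rewrite /= /bump /=; lia.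
have -> : (0%Z - N.+1%:Z) = - N.+1%:Z by rewrite sub0r.
have -> : (bump 0 N.*2.+1)%:Z - N.+1%:Z = N.+1%:Z by rewrite /bump /=; lia.
rewrite IH [in RHS]big_ord_recr /= [LHS]addrCA -!addrA.
by congr (_ + (_ + _)); rewrite addrC.
Qed.

(** Expand each term as [(1 - w ^ M)^-1] times a finite geometric sum: the sum
    over the roots of unity kills every power of [w] except the 0-th. *)
Lemma sum_geometric_roots (F : fieldType) (w eta : F) (M : nat) :
  (0 < M)%N -> eta ^+ M = 1 -> (forall j, (0 < j < M)%N -> eta ^+ j != 1) ->
  w ^+ M != 1 -> \sum_(k < M) (1 - w * eta ^+ k)^-1 = M%:R / (1 - w ^+ M).
Proof.
move=> M0 etaM eta1 w1.
have wM0 : 1 - w ^+ M != 0 by rewrite subr_eq0 eq_sym.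
have E k : (1 - w * eta ^+ k)^-1 = (\sum_(j < M) (w * eta ^+ k) ^+ j) / (1 - w ^+ M).
  have H : (1 - w * eta ^+ k) * \sum_(j < M) (w * eta ^+ k) ^+ j = 1 - w ^+ M.
    have /(congr1 -%R) := subrX1 (w * eta ^+ k) M.
    by rewrite -mulNr !opprB exprMn -exprM mulnC exprM etaM expr1n mulr1 => ->.
  have wk0 : 1 - w * eta ^+ k != 0.
    by apply: contra_neq wM0 => h0; rewrite -H h0 mul0r.
  by apply: (mulfI wk0); rewrite mulfV// mulrA H mulfV.
under eq_bigr do rewrite E.
rewrite -mulr_suml exchange_big /= (bigD1 (Ordinal M0)) //= [X in _ + X]big1 ?addr0; last first.
  move=> [j jM] /= j0.
  have {}j0 : (0 < j)%N by rewrite lt0n.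
  have ej : eta ^+ j != 1 by rewrite eta1// j0.
  under eq_bigr => k _ do rewrite exprMn -exprM mulnC exprM.
  rewrite -mulr_sumr; have := subrX1 (eta ^+ j) M.
  rewrite -exprM mulnC exprM etaM expr1n subrr => /esym/eqP.
  by rewrite mulf_eq0 subr_eq0 (negbTE ej) /= => /eqP ->; rewrite mulr0.
under eq_bigr do rewrite expr0.
by rewrite sumr_const card_ord.
Qed.

End FiniteSums.

Section RealBounds.
Variable R : realType.

Lemma cos_lt1 (x : R) : 0 < x < pi *+ 2 -> cos x < 1.
Proof.
move=> /andP[x0 x2].
have -> : x = (x / 2) *+ 2 by rewrite -mulr_natr divfK.
have s0 : 0 < sin (x / 2).
  apply: sin_gt0_pi; rewrite divr_gt0//= ltr_pdivrMr//.
  by rewrite mulr_natr.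
rewrite cos_mulr2n cos2sin2 mulr2n.
have : 0 < sin (x / 2) ^+ 2 by rewrite exprn_gt0.
by lra.
Qed.

(** From [sin x = 2 sin (x / 2) cos (x / 2)] and the mean value theorem, since
    [x / 2 < 1]; any positive constant suffices. *)
Lemma sin_ge_linear (x : R) : 0 <= x <= pi / 2 -> cos 1 ^+ 2 * x <= sin x.
Proof.
move=> /andP[x0 x2].
have [->|xn0] := eqVneq x 0; first by rewrite mulr0 sin0.
have y1 : x / 2 < 1.
  rewrite ltr_pdivrMr// mul1r (le_lt_trans x2)// pihalf_lt2//.
have y0 : 0 < x / 2 by rewrite divr_gt0// lt_def xn0 x0.
have pi1 : (1 : R) <= pi by rewrite (le_trans _ (pi_ge2 R))// ler1n.
have cos_ge c : 0 <= c <= x / 2 -> cos 1 <= cos c :> R.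
  move=> /andP[c0 cx]; have [c1] : c < 1 by exact: le_lt_trans y1.
  apply: ltW; rewrite ltr_cos ?in_itv/= ?c0 ?ler01 ?pi1 ?(le_trans (ltW _) pi1)//.
have [c cx sE] : exists2 c, c \in `]0, (x/2)[ & sin (x / 2) - sin 0 = cos c * (x / 2 - 0) :> R.
  apply: MVT => //; apply: continuous_subspaceT; exact: continuous_sin.
have sx : cos 1 * (x / 2) <= sin (x / 2).
  move: sE; rewrite sin0 !subr0 => ->; rewrite ler_pM2r//; apply: cos_ge.
  by move: cx; rewrite in_itv/= => /andP[? ?]; rewrite !ltW.
have -> : sin x = sin (x / 2 *+ 2) by congr sin; rewrite -mulr_natr divfK.
rewrite sin_mulr2n.
have -> : cos 1 ^+ 2 * x = (cos 1 * (cos 1 * (x / 2))) *+ 2 :> R.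
  by rewrite -mulr_natr; field.
rewrite lerMn2r/=; apply: ler_pM => //.
- exact/ltW/cos1_gt0.
- by rewrite mulr_ge0// ltW// cos1_gt0.
- by apply: cos_ge; rewrite ltW//= lexx.
Qed.

Lemma sum_inv_sqr_le (N K : nat) : (0 < N)%N ->
  \sum_(N <= n < K) (n.+1%:R ^+ 2)^-1 <= N%:R^-1 :> R.
Proof.
move=> N0; have [KN|NK] := leqP K N; first by rewrite big_geq// invr_ge0.
apply: (@le_trans _ _ (\sum_(N <= n < K) (n%:R^-1 - n.+1%:R^-1))).
  rewrite big_nat [leRHS]big_nat; apply: ler_sum => n /andP[Nn _].
  have n0 : (0 : R) < n%:R by rewrite ltr0n (leq_trans N0).
  have n1 : (0 : R) < n.+1%:R by rewrite ltr0n.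
  have -> : n%:R^-1 - n.+1%:R^-1 = (n%:R * n.+1%:R)^-1 :> R.
    by move: n1; rewrite -natr1 => n1; field; rewrite !gt_eqF.
  by rewrite lef_pV2 ?posrE ?exprn_gt0 ?mulr_gt0// expr2 ler_pM2r// ler_nat.
under eq_bigr do rewrite -[_ - _]opprB.
by rewrite sumrN telescope_sumr ?(ltnW NK)// opprB lerBlDr lerDl invr_ge0.
Qed.

End RealBounds.

Section Tannery.
Variable R : realType.
Notation normc := Normc.normc.

Lemma normc_sum_le (I : Type) (r : seq I) (P : pred I) (F : I -> R[i]) :
  normc (\sum_(i <- r | P i) F i) <= \sum_(i <- r | P i) normc (F i).
Proof.
elim/big_ind2: _ => //; first by rewrite Normc.normc0.
by move=> x y z t xy zt; rewrite (le_trans (normc_triangle _ _))// lerD.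
Qed.

Lemma cvg_sum_fin (f : nat -> nat -> R) N : (forall n, f ^~ n @ \oo --> (0 : R)) ->
  (fun K => \sum_(0 <= n < N) f K n) @ \oo --> (0 : R).
Proof.
move=> f0; elim: N => [|N IH].
  under eq_fun do rewrite big_geq//; exact: cvg_cst.
under eq_fun do rewrite big_nat_recr//=.
have H := cvgD IH (f0 N); rewrite addr0 in H; exact: H.
Qed.

(** Dominated convergence for sums whose length grows with the index: the head
    converges term by term, and the tail is at most that of a convergent series. *)
Lemma tannery (a : nat -> nat -> R[i]) (b : nat -> R[i]) (c : R) (n0 K0 : nat) :
  (forall n, ccvg (a ^~ n) (b n)) ->
  (forall K n, (K0 <= K)%N -> (n0 <= n < K)%N ->
     normc (a K n) <= c / n.+1%:R ^+ 2) ->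
  ccvg (fun K => \sum_(n < K) (a K n - b n)) 0.
Proof.
move=> ab ac.
have bc n : (n0 <= n)%N -> normc (b n) <= c / n.+1%:R ^+ 2.
  move=> nn; apply: (cvgr_to_le (ccvg_normc (ab n))); near=> K.
  by apply: ac; [near: K; exact: nbhs_infty_ge|rewrite nn/=; near: K; exact: nbhs_infty_gt].
have abc K n : (K0 <= K)%N -> (n0 <= n < K)%N ->
    normc (a K n - b n) <= (c * 2) / n.+1%:R ^+ 2.
  move=> KK nn; rewrite (le_trans (normc_triangle _ _))//.
  rewrite normcN mulrAC mulr2n mulrDr mulr1 lerD// ?ac// bc//.
  by case/andP: nn.
have f0 n : (fun K => normc (a K n - b n)) @ \oo --> (0 : R) by exact/ccvg_dist.
have c0 : 0 <= c.
  have := normc_ge0 (b n0); move=> /le_trans /(_ (bc _ (leqnn _))).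
  by rewrite pmulr_lge0// invr_gt0 exprn_gt0.
apply/ccvg_dist; under eq_fun do rewrite subr0.
apply/cvgrPdist_lt => e e0.
(* The tails from N on contribute at most 2 c / N in total. *)
pose N := maxn n0 (Num.truncn (c * 4 / e)).+1.
have N0 : (0 < N)%N by rewrite leq_max orbT.
have NE : c * 2 * N%:R^-1 < e / 2.
  rewrite ltr_pdivrMr ?ltr0n//; apply: (@lt_le_trans _ _ (e / 2 * (Num.truncn (c * 4 / e)).+1%:R)).
    rewrite [ltRHS]mulrC -ltr_pdivrMr ?divr_gt0//.
    by rewrite (_ : _ / _ = c * 4 / e) ?truncnS_gt//; field; rewrite gt_eqF.
  by rewrite ler_pM2l ?divr_gt0// ler_nat leq_max leqnn orbT.
near=> K.
rewrite sub0r normrN ger0_norm ?normc_ge0//.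
apply: le_lt_trans (normc_sum_le _ _ _) _.
rewrite -(big_mkord xpredT (fun n => normc (a K n - b n))) /=.
have NK : (N <= K)%N by near: K; exact: nbhs_infty_ge.
rewrite (big_cat_nat (n := N))//= (splitr e) ltrD//.
  rewrite -[X in X < _]ger0_norm ?sumr_ge0// => [|n _]; last exact: normc_ge0.
  near: K; have h := cvg_sum_fin N f0; have e2 : 0 < e / 2 by rewrite divr_gt0.
  by apply: cvgr0_norm_lt h _ e2.
apply: le_lt_trans NE; apply: (@le_trans _ _ (\sum_(N <= n < K) (c * 2 / n.+1%:R ^+ 2))).
  rewrite big_nat [leRHS]big_nat; apply: ler_sum => n /andP[Nn nK].
  apply: abc; first by near: K; exact: nbhs_infty_ge.
  by rewrite nK andbT (leq_trans _ Nn)// leq_max leqnn.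
by rewrite -mulr_sumr ler_wpM2l ?mulr_ge0// sum_inv_sqr_le.
Unshelve. all: by end_near. Qed.

End Tannery.

Section PartialFractions.
Variable R : realType.
Notation normc := Normc.normc.
Implicit Types u w : R[i].

Definition unity_root (M : nat) : R[i] := expi (2 * pi / M%:R).

Lemma expiD (s t : R) : expi (s + t) = expi s * expi t :> R[i].
Proof. by rewrite /expi cosD sinD; apply/eqP; rewrite eq_complex/= eqxx addrC eqxx. Qed.

Lemma expiMn (t : R) n : expi (n%:R * t) = expi t ^+ n :> R[i].
Proof.
elim: n => [|n IH]; first by rewrite mul0r /expi cos0 sin0.
by rewrite -natr1 mulrDl mul1r expiD IH exprSr.
Qed.

Lemma expi_neq1 (t : R) : 0 < t < pi *+ 2 -> expi t != 1 :> R[i].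
Proof.
by move=> /cos_lt1 c1; apply/eqP => /(congr1 (@complex.Re R)) /= c2; rewrite c2 ltxx in c1.
Qed.

Lemma unity_rootX M : (0 < M)%N -> unity_root M ^+ M = 1.
Proof.
move=> M0; rewrite -expiMn mulrC divfK ?pnatr_eq0 -?lt0n//.
by rewrite /expi mulr_natl cos2pi sin2pi.
Qed.

Lemma unity_rootX_neq1 M j : (0 < j < M)%N -> unity_root M ^+ j != 1.
Proof.
move=> /andP[j0 jM]; rewrite -expiMn; apply: expi_neq1.
have M0 : (0 : R) < M%:R by rewrite ltr0n (leq_trans _ jM).
rewrite !mulr_gt0 ?pi_gt0 ?invr_gt0 ?(ltr0n _ j)//=.
rewrite mulrA ltr_pdivrMr ?M0// -(mulr_natl pi 2) [ltLHS]mulrC ltr_pM2l ?mulr_gt0 ?pi_gt0//.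
by rewrite ltr_nat.
Qed.

Lemma cexp_neq1 u : 0 < complex.Re u -> cexp (- u) != 1.
Proof.
move=> u0; apply/eqP => /(congr1 (fun z => normc z)); rewrite normc_cexp Normc.normc1 raddfN/=.
by move/eqP; rewrite lt_eqF// expR_lt1 oppr_lt0.
Qed.

(** An exact identity that already has the shape of the limit: for large [K]
    the [k]-th term is close to [(u - 2 i pi (k - K))^-1], so the indices are
    centred around the pole 0. *)
Lemma finite_partial_fractions u (K : nat) : 0 < complex.Re u ->
  let M := K.*2.+1 in
  let w := cexp (- (M%:R^-1 * u)) in
  (1 - cexp (- u))^-1 = M%:R^-1 * \sum_(k < M) (1 - w * unity_root M ^ (k%:Z - K%:Z))^-1.
Proof.
move=> u0 M w.
have M0 : (M%:R : R[i]) != 0 by rewrite pnatr_eq0.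
have wM : w ^+ M = cexp (- u).
  by rewrite -cexpMn mulrN mulrA mulfV// mul1r.
have r0 : unity_root M != 0.
  by apply/eqP => r0; have /eqP := @unity_rootX M erefl; rewrite r0 expr0n eq_sym oner_eq0.
have E (k : 'I_M) : (1 - w * unity_root M ^ (k%:Z - K%:Z))^-1
    = (1 - w * (unity_root M ^+ K)^-1 * unity_root M ^+ k)^-1.
  by rewrite expfzDr// -exprnN -mulrA [_^-1 * _]mulrC.
under eq_bigr do rewrite E.
have wM' : (w / unity_root M ^+ K) ^+ M = cexp (- u).
  by rewrite exprMn wM exprVn -exprM mulnC exprM unity_rootX// expr1n invr1 mulr1.
rewrite sum_geometric_roots ?wM' ?cexp_neq1 ?unity_rootX//.
  by rewrite mulrA mulVf// mul1r.
exact: unity_rootX_neq1.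
Qed.

(** Opposite poles are grouped because the series converges only
    conditionally. The terms 1 of the pairs add up to the constant [1 / 2] of the
    expansion. *)
Lemma pair_fractions (w eta : R[i]) : w != 0 -> eta != 0 -> w * eta != 1 ->
  w / eta != 1 ->
  (1 - w * eta)^-1 + (1 - w / eta)^-1 =
  1 + (w^-1 - w) / ((w^-1 + w - 2) + (2 - eta - eta^-1)).
Proof.
move=> w0 e0 we1 we2.
have D1 : 1 - w * eta != 0 by rewrite subr_eq0 eq_sym.
have D2 : 1 - w / eta != 0 by rewrite subr_eq0 eq_sym.
have D : (w^-1 + w - 2) + (2 - eta - eta^-1) = w^-1 * ((1 - w * eta) * (1 - w / eta)).
  by field; rewrite w0 e0.
rewrite D; field; rewrite e0 w0 D1 andbT.
by apply: contra_neq D2 => ew; rewrite -[1](mulfV e0) -mulrBl ew mul0r.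
Qed.

Lemma two_sub_expi (t : R) : 2 - expi t - (expi t)^-1 = ((2 * sin (t / 2)) ^+ 2)%:C :> R[i].
Proof.
have -> : (expi t)^-1 = expi (- t) :> R[i].
  have e0 : expi t != 0 :> R[i] by rewrite -normc_neq0 normc_expi oner_eq0.
  by apply: (mulfI e0); rewrite mulfV// -expiD subrr /expi cos0 sin0.
have -> : expi t = expi ((t / 2) *+ 2) :> R[i] by congr expi; field.
have -> : expi (- t) = expi (- ((t / 2) *+ 2)) :> R[i] by congr expi; field.
rewrite /expi cosN sinN cos_mulr2n cos2sin2.
apply/eqP; rewrite eq_complex/=; apply/andP; split; apply/eqP; ring.
Qed.

(** Difference quotient of the exponential at 0 with step [1 / M], [M = 2 K + 1]. *)
Definition cexp_slope (K : nat) (z : R[i]) : R[i] :=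
  K.*2.+1%:R * (cexp (K.*2.+1%:R^-1 * z) - 1).

(** [M |1 - e^(2 i pi (n + 1) / M)|] for [M = 2 K + 1], which tends to
    [2 pi (n + 1)]. *)
Definition chord (K n : nat) : R :=
  2 * (K.*2.+1%:R * sin (pi * n.+1%:R / K.*2.+1%:R)).

(** The contribution of the two poles of index [n + 1] and [- (n + 1)], normalized
    by powers of [M] so that numerator and denominator converge. *)
Definition trig_fraction u (K n : nat) : R[i] :=
  (cexp_slope K u - cexp_slope K (- u)) /
  (- (cexp_slope K u * cexp_slope K (- u)) + (chord K n ^+ 2)%:C).

Lemma cvg_double : (fun K : nat => K.*2) @ \oo --> \oo.
Proof.
apply/cvgnyPge => A; near=> K; apply: (@leq_trans K); last by rewrite -addnn leq_addr.
by near: K; exact: nbhs_infty_ge.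
Unshelve. all: by end_near. Qed.

Lemma ccvg_cexp_slope z : ccvg (cexp_slope ^~ z) z.
Proof.
have [h1 h2] := ccvg_cexp_derivative z.
by split; [exact: (cvg_comp _ _ cvg_double h1)|exact: (cvg_comp _ _ cvg_double h2)].
Qed.

Lemma finite_trig_fractions u (K : nat) : 0 < complex.Re u ->
  (1 - cexp (- u))^-1 - 2^-1 =
  - (cexp_slope K (- u))^-1 - K.*2.+1%:R^-1 / 2 + \sum_(n < K) trig_fraction u K n.
Proof.
move=> u0; rewrite (finite_partial_fractions K u0) /=.
set M := K.*2.+1; set w := cexp (- _).
have M0 : (M%:R : R[i]) != 0 by rewrite pnatr_eq0.
have wE : w = cexp (M%:R^-1 * - u) by rewrite mulrN.
have w0 : w != 0 by exact: cexp_neq0.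
have wV : w^-1 = cexp (M%:R^-1 * u) by rewrite /w cexpN invrK.
have wM : w ^+ M = cexp (- u).
  by rewrite -cexpMn mulrN mulrA mulfV// mul1r.
have r0 : unity_root M != 0.
  by apply/eqP => r0; have /eqP := @unity_rootX M erefl; rewrite r0 expr0n eq_sym oner_eq0.
have wr m : w * unity_root M ^ m != 1.
  apply/eqP => /(congr1 (fun z => z ^+ M)); rewrite expr1n exprMn wM.
  rewrite exprnP exprzAC -exprnP unity_rootX// exp1rz mulr1 => /eqP.
  by rewrite (negbTE (cexp_neq1 u0)).
rewrite (sum_symmetric (fun m => (1 - w * unity_root M ^ m)^-1)) expr0z mulr1.
have E (n : 'I_K) : (1 - w * unity_root M ^ n.+1%:Z)^-1 + (1 - w * unity_root M ^ (- n.+1%:Z))^-1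
   = 1 + M%:R * trig_fraction u K n.
  have h1 := wr n.+1; have h2 := wr (- n.+1%:Z).
  rewrite -?exprnN -?exprnP in h1 h2 *; rewrite pair_fractions ?expf_neq0//.
  rewrite -expiMn two_sub_expi /trig_fraction /cexp_slope -/M -wE -wV /chord -/M.
  congr (1 + _).
  have -> : sin (n.+1%:R * (2 * pi / M%:R) / 2) = sin (pi * n.+1%:R / M%:R) :> R.
    by congr sin; field; rewrite pnatr_eq0.
  set s := sin _.
  have -> : ((2 * (M%:R * s)) ^+ 2)%:C = M%:R ^+ 2 * ((2 * s) ^+ 2)%:C :> R[i].
    by rewrite !rmorphXn !rmorphM /= !rmorph_nat; ring.
  set D := w^-1 + w - 2 + _.
  have -> : - (M%:R * (w^-1 - 1) * (M%:R * (w - 1))) + M%:R ^+ 2 * ((2 * s) ^+ 2)%:C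
      = M%:R ^+ 2 * D by rewrite /D; field.
  rewrite (invfM (M%:R ^+ 2)); move: (D^-1) => Di.
  by clearbody w; field; rewrite M0 w0.
rewrite (eq_bigr _ (fun n _ => E n)).
rewrite big_split/= sumr_const card_ord -mulr_sumr.
rewrite /cexp_slope -/M -wE.
have ME : (M%:R : R[i]) = 2 * K%:R + 1 by rewrite /M -natr1 -mul2n natrM.
have w1 : 1 - w != 0 by have := wr 0; rewrite expr0z mulr1 subr_eq0 eq_sym.
have w1' : w - 1 != 0 by rewrite -opprB oppr_eq0.
by move: M0; rewrite ME => M0; clearbody w; field; rewrite M0 w1 w1'.
Qed.

Lemma cvg_chord n : (fun K => chord K n) @ \oo --> (2 * pi * n.+1%:R : R).
Proof.
have [_ h] := ccvg_cexp_slope (pi * n.+1%:R)*i.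
rewrite -mulrA; apply: cvgM; first exact: cvg_cst.
apply: cvg_trans h; apply: near_eq_cvg; apply: nearW => K /=.
have E : K.*2.+1%:R^-1 = (K.*2.+1%:R^-1)%:C :> R[i] by rewrite real_complex_nat fmorphV.
rewrite /cexp_slope E (real_complex_nat R K.*2.+1) complex_ImZ raddfB/= /cexp.
rewrite ?(complex_ReZ, complex_ImZ) /=.
by rewrite !(mulr0, mul0r, subr0, addr0) expR0 mul1r [_^-1 * _]mulrC.
Qed.

Lemma chord_ge (K n : nat) : (n < K)%N ->
  (4 * cos 1 ^+ 2 ^+ 2 * pi ^+ 2) * n.+1%:R ^+ 2 <= chord K n ^+ 2.
Proof.
move=> nK; have M0 : (0 : R) < K.*2.+1%:R by rewrite ltr0n.
have c0 : (0 : R) <= cos 1 by exact/ltW/cos1_gt0.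
set x : R := pi * n.+1%:R / K.*2.+1%:R.
have hx : 0 <= x <= @pi R / 2.
  rewrite /x.
  apply/andP; split; first by rewrite divr_ge0 ?mulr_ge0 ?pi_ge0.
  rewrite ler_pdivrMr//.
  rewrite mulrAC -mulrA ler_pM2l ?pi_gt0// ler_pdivlMr//.
  by rewrite -natrM ler_nat; lia.
have h := sin_ge_linear hx.
have -> : 4 * cos 1 ^+ 2 ^+ 2 * pi ^+ 2 * n.+1%:R ^+ 2 =
  (2 * (K.*2.+1%:R * (cos 1 ^+ 2 * (pi * n.+1%:R / K.*2.+1%:R)))) ^+ 2 :> R.
  by field; rewrite gt_eqF.
have x0 : 0 <= cos 1 ^+ 2 * x.
  by case/andP: hx => x0 _; rewrite mulr_ge0// exprn_ge0.
have X0 : 0 <= 2 * (K.*2.+1%:R * (cos 1 ^+ 2 * x)).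
  by apply: mulr_ge0 => //; apply: mulr_ge0; first exact: ltW.
have XY : 2 * (K.*2.+1%:R * (cos 1 ^+ 2 * x)) <= chord K n.
  by rewrite /chord ler_pM2l// ler_pM2l.
by rewrite -/x expr2 [leRHS]expr2; apply: ler_pM.
Qed.

Definition coth_fraction u (n : nat) : R[i] :=
  (2 * u) / (u ^+ 2 + ((2 * pi * n.+1%:R) ^+ 2)%:C).

Lemma coth_denominator_neq0 u n : 0 < complex.Re u ->
  u ^+ 2 + ((2 * pi * n.+1%:R) ^+ 2)%:C != 0.
Proof.
move=> u0; set r := 2 * pi * _.
have -> : u ^+ 2 + (r ^+ 2)%:C = (u - r*i) * (u + r*i).
  rewrite -subr_sqr (_ : r*i ^+ 2 = - (r ^+ 2)%:C) ?opprK//.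
  by apply/eqP; rewrite eq_complex /= expr2/=; apply/andP; split; apply/eqP; ring.
by rewrite mulf_neq0//; apply: contraTneq u0 => /(congr1 (@complex.Re R));
  rewrite raddfD/= ?oppr0 addr0 => ->; rewrite ltxx.
Qed.

Lemma ccvg_trig_fraction u n : 0 < complex.Re u ->
  ccvg (fun K => trig_fraction u K n) (coth_fraction u n).
Proof.
move=> u0; have h1 := ccvg_cexp_slope u; have h2 := ccvg_cexp_slope (- u).
have -> : coth_fraction u n = (u - (- u)) / (- (u * - u) + ((2 * pi * n.+1%:R) ^+ 2)%:C).
  by rewrite /coth_fraction opprK mulrN opprK -expr2 mulr_natl mulr2n.
apply: ccvgM; first exact: ccvgB.
apply: ccvgV.
  by rewrite mulrN opprK -expr2 coth_denominator_neq0.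
apply: ccvgD; first by apply: ccvgN; exact: ccvgM.
apply: ccvg_real; rewrite expr2; under eq_fun do rewrite expr2.
by apply: cvgM; exact: cvg_chord.
Qed.

(** The chords grow linearly in [n], uniformly in [K], whereas the other terms
    of the fraction converge and so remain bounded. *)
Lemma normc_trig_fraction u : exists (c : R) (n0 K0 : nat),
  forall K n, (K0 <= K)%N -> (n0 <= n < K)%N ->
    normc (trig_fraction u K n) <= c / n.+1%:R ^+ 2.
Proof.
pose d : R := 4 * cos 1 ^+ 2 ^+ 2 * pi ^+ 2.
have d0 : 0 < d by rewrite !mulr_gt0 ?exprn_gt0 ?cos1_gt0 ?pi_gt0.
have h1 := ccvg_cexp_slope u; have h2 := ccvg_cexp_slope (- u).
have hA := ccvg_normc (ccvgB h1 h2).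
have hB := ccvg_normc (ccvgN (ccvgM h1 h2)).
set A := normc _ in hA; set B := normc _ in hB.
have B0 : 0 <= B by exact: normc_ge0.
have [K1 _ HA] : \forall K \near \oo, normc (cexp_slope K u - cexp_slope K (- u)) <= A + 1.
  by apply: (cvgr_le _ hA); rewrite ltrDl.
have [K2 _ HB] : \forall K \near \oo, normc (- (cexp_slope K u * cexp_slope K (- u))) <= B + 1.
  by apply: (cvgr_le _ hB); rewrite ltrDl.
exists ((A + 1) * (2 / d)), (Num.truncn (2 * (B + 1) / d)).+1, (maxn K1 K2) => K n.
rewrite geq_max => /andP[/HA /= {}HA /HB /= {}HB] /andP[nn nK].
rewrite /trig_fraction Normc.normcM Normc.normcV -[leRHS]mulrA.
set D := - (_ * _) + _.
have E : d / 2 * n.+1%:R ^+ 2 <= normc D.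
  have : normc (chord K n ^+ 2)%:C <= normc D + normc (cexp_slope K u * cexp_slope K (- u)).
    rewrite (_ : (chord K n ^+ 2)%:C = D + (cexp_slope K u * cexp_slope K (- u))).
      exact: normc_triangle.
    by rewrite /D addrAC addNr add0r.
  have -> : normc (chord K n ^+ 2)%:C = chord K n ^+ 2.
    by rewrite /= expr0n/= addr0 sqrtr_sqr ger0_norm// sqr_ge0.
  move: HB; rewrite normcN => HB h.
  have hc := chord_ge nK; rewrite -/d in hc.
  have dn : B + 1 <= d / 2 * n.+1%:R ^+ 2.
    have h3 : 2 * (B + 1) / d <= n.+1%:R.
      apply: ltW; apply: lt_le_trans (truncnS_gt _) _.
      by rewrite ler_nat (leq_trans nn).
    have h4 : n.+1%:R <= n.+1%:R ^+ 2 :> R by rewrite ler_eXnr// ler1n.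
    have := le_trans h3 h4; rewrite ler_pdivrMr// => h5.
    by rewrite mulrAC ler_pdivlMr// mulrC [d * _]mulrC.
  have -> : d / 2 * n.+1%:R ^+ 2 = d * n.+1%:R ^+ 2 - d / 2 * n.+1%:R ^+ 2 by field.
  lra.
have ED : 0 < d / 2 * n.+1%:R ^+ 2 by rewrite mulr_gt0// divr_gt0.
apply: ler_pM => //; rewrite ?normc_ge0 ?invr_ge0 ?normc_ge0//.
have -> : 2 / d / n.+1%:R ^+ 2 = (d / 2 * n.+1%:R ^+ 2)^-1.
  by field; rewrite !gt_eqF// ltr0n.
by rewrite lef_pV2// posrE (lt_le_trans ED).
Qed.

Lemma ccvg_harmonic0 : ccvg (fun K => (K.*2.+1%:R^-1 : R[i])) 0.
Proof.
have h := cvg_comp _ _ cvg_double (@cvg_harmonic R).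
have := ccvg_real h; congr ccvg; apply/funext => K /=.
by rewrite [in RHS]real_complex_nat fmorphV.
Qed.

(** The exact identity [finite_trig_fractions] passes to the limit term by term
    by Tannery's theorem. *)
Lemma partial_fractions u : 0 < complex.Re u ->
  ccvg (fun N => \sum_(k < N.*2.+1) (u - 2 * 'i * pi%:C * (k%:Z - N%:Z)%:~R)^-1)
       ((1 - cexp (- u))^-1 - 2^-1).
Proof.
move=> u0.
have un0 : u != 0 by apply: contraTneq u0 => ->; rewrite ltxx.
have E N : \sum_(k < N.*2.+1) (u - 2 * 'i * pi%:C * (k%:Z - N%:Z)%:~R)^-1 =
    u^-1 + \sum_(n < N) coth_fraction u n.
  rewrite (sum_symmetric (fun m => (u - 2 * 'i * pi%:C * m%:~R)^-1)) mulr0 subr0.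
  congr (_ + _); apply: eq_bigr => n _; have := coth_denominator_neq0 n u0.
  rewrite /coth_fraction.
  have -> : u ^+ 2 + ((2 * pi * n.+1%:R) ^+ 2)%:C =
     (u - 2 * 'i * pi%:C * n.+1%:R) * (u + 2 * 'i * pi%:C * n.+1%:R).
    have i2 := sqrCi R[i]; rewrite rmorphXn !rmorphM /= !rmorph_nat.
    by ring: i2.
  rewrite mulf_eq0 negb_or => /andP[d1 d2].
  rewrite rmorphN /= -pmulrn mulrN opprK.
  move: (2 * 'i * pi%:C * n.+1%:R) d1 d2 => t d1 d2.
  by field; rewrite d1 d2.
have [c [n0 [K0 bnd]]] := normc_trig_fraction u.
have T := tannery (fun n => ccvg_trig_fraction n u0) bnd.
have F N : u^-1 + \sum_(n < N) coth_fraction u n =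
   ((1 - cexp (- u))^-1 - 2^-1) + (u^-1 + (cexp_slope N (- u))^-1) + N.*2.+1%:R^-1 / 2 -
   \sum_(n < N) (trig_fraction u N n - coth_fraction u n).
  by rewrite (finite_trig_fractions N u0) big_split/= sumrN; ring.
under eq_fun do rewrite E F.
move: ((1 - cexp (- u))^-1 - 2^-1) => l.
rewrite [X in ccvg _ X](_ : l = l + (u^-1 + (- u)^-1) + 0 / 2 - 0); last first.
  by rewrite invrN subrr mul0r subr0 !addr0.
apply: ccvgB T; apply: ccvgD; last by apply: ccvgM ccvg_harmonic0 (ccvg_cst _).
apply: ccvgD; first exact: ccvg_cst.
apply: ccvgD; first exact: ccvg_cst.
by apply: ccvgV; [rewrite oppr_eq0|exact: ccvg_cexp_slope].
Qed.

End PartialFractions.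

(** * Multiplication operators and limits in [L2] *)

Section SquareNorm.
Context d (T : measurableType d) (R : realType) (mu : {measure set T -> \bar R}).
Implicit Types (f g h : L2 mu).

Definition nsq (z : R[i]) : R := complex.Re z ^+ 2 + complex.Im z ^+ 2.

Lemma nsq_ge0 z : 0 <= nsq z. Proof. by rewrite addr_ge0// sqr_ge0. Qed.

Lemma nsqM z w : nsq (z * w) = nsq z * nsq w.
Proof. by case: z w => [a b] [c d']; rewrite /nsq /=; ring. Qed.

Lemma nsq_eq0 z : nsq z = 0 -> z = 0.
Proof.
move/eqP; rewrite paddr_eq0 ?sqr_ge0// !sqrf_eq0 => /andP[/eqP a /eqP b].
by case: z a b => [x y] /= -> ->.
Qed.

Lemma nsqN z : nsq (- z) = nsq z.
Proof. by case: z => [a b]; rewrite /nsq /= !sqrrN. Qed.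

Lemma nsqD_le z w : nsq (z + w) <= 2 * nsq z + 2 * nsq w.
Proof.
case: z w => [a b] [c d']; rewrite /nsq /=; rewrite -subr_ge0.
rewrite (_ : _ - _ = (a - c) ^+ 2 + (b - d') ^+ 2); last by ring.
by rewrite addr_ge0// sqr_ge0.
Qed.

Lemma nsq_conj z : z * z^* = (nsq z)%:C.
Proof.
case: z => a b; apply/eqP; rewrite eq_complex/= /nsq /=.
by apply/andP; split; apply/eqP; ring.
Qed.

Lemma ccvg_nsq (u : nat -> R[i]) l : ccvg u l -> (fun n => nsq (u n - l)) @ \oo --> (0 : R).
Proof.
move=> ul; have /ccvg_dist h := ul.
rewrite -(mulr0 (0 : R)); under eq_fun do rewrite /nsq -normc_sqr expr2.
exact: cvgM.
Qed.

(** All estimates and limits in [L2] use this real number; the norm itself takes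
    its values in [R[i]]. *)
Definition normsq (f : L2 mu) : R := complex.Re (L2dot f f).

Lemma normsq_ge0 f : 0 <= normsq f.
Proof.
have : 0 <= L2dot f f by exact: dnorm_ge0.
by rewrite lecE => /andP[].
Qed.

Lemma L2dotE f : L2dot f f = (normsq f)%:C.
Proof.
have : 0 <= L2dot f f by exact: dnorm_ge0.
by rewrite /normsq; case: (L2dot f f) => a b; rewrite lecE /= => /andP[/eqP -> _].
Qed.

Lemma normsq_eq0 f : normsq f = 0 -> f = 0.
Proof.
move=> f0; apply/eqP; apply: contraT => /L2dot_gt0.
by rewrite L2dotE f0 ltxx.
Qed.

Lemma L2norm_sqr f : `|f| ^+ 2 = (normsq f)%:C.
Proof. by rewrite [`|f|]/(sqrtC _) sqrtCK L2dotE. Qed.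

Lemma L2dotDl f g h : L2dot (f + g) h = L2dot f h + L2dot g h.
Proof. exact: linearDl. Qed.

Lemma L2dotDr f g h : L2dot h (f + g) = L2dot h f + L2dot h g.
Proof. exact: linearDr. Qed.

Lemma L2dotNl f h : L2dot (- f) h = - L2dot f h.
Proof. exact: linearNl. Qed.

Lemma L2dotNr f h : L2dot h (- f) = - L2dot h f.
Proof. exact: linearNr. Qed.

Lemma L2dotZl a f h : L2dot (a *: f) h = a * L2dot f h.
Proof. exact: linearZl_LR. Qed.

Lemma L2dotZr a f h : L2dot h (a *: f) = a^* * L2dot h f.
Proof. exact: linearZr_LR. Qed.

Lemma normsq0 : normsq 0 = 0.
Proof. by rewrite /normsq linear0l. Qed.

Lemma normsqN f : normsq (- f) = normsq f.
Proof. by rewrite /normsq linearNl linearNr opprK. Qed.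

(** From the parallelogram identity; it does the work of the triangle inequality
    in limits. *)
Lemma normsqD_le f g : normsq (f + g) <= 2 * normsq f + 2 * normsq g.
Proof.
have := normsq_ge0 (f - g); rewrite /normsq !(L2dotDl, L2dotDr, L2dotNl, L2dotNr).
move: (L2dot f f) (L2dot f g) (L2dot g f) (L2dot g g) => a b c e.
rewrite !(raddfD, raddfN) /=; lra.
Qed.

Lemma pythagoras f g : L2dot f g = 0 -> normsq (f + g) = normsq f + normsq g.
Proof.
move=> fg0; have gf0 : L2dot g f = 0 by rewrite L2dotC fg0 rmorph0.
by rewrite /normsq !(L2dotDl, L2dotDr) fg0 gf0 add0r addr0 raddfD.
Qed.

Definition Cmeas (k : T -> R[i]) := measurable_fun setT (fun x => complex.Re (k x))
  /\ measurable_fun setT (fun x => complex.Im (k x)).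

Lemma Cmeas_cst c : Cmeas (fun=> c).
Proof. by split; exact: measurable_cst. Qed.

Lemma CmeasD k l : Cmeas k -> Cmeas l -> Cmeas (fun x => k x + l x).
Proof.
move=> [k1 k2] [l1 l2]; split.
  by under eq_fun do rewrite raddfD/=; exact: measurable_funD.
by under eq_fun do rewrite raddfD/=; exact: measurable_funD.
Qed.

Lemma CmeasM k l : Cmeas k -> Cmeas l -> Cmeas (fun x => k x * l x).
Proof.
move=> [k1 k2] [l1 l2]; split.
  under eq_fun do rewrite complex_ReM; apply: measurable_funB; exact: measurable_funM.
under eq_fun do rewrite complex_ImM; apply: measurable_funD; exact: measurable_funM.
Qed.

Lemma CmeasN k : Cmeas k -> Cmeas (fun x => - k x).
Proof.
move=> kc; rewrite (_ : (fun x => _) = (fun x => (-1) * k x)).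
  exact: CmeasM (Cmeas_cst _) kc.
by apply/funext => x; rewrite mulN1r.
Qed.

Lemma CmeasB k l : Cmeas k -> Cmeas l -> Cmeas (fun x => k x - l x).
Proof. by move=> kc lc; apply: CmeasD => //; exact: CmeasN. Qed.

Lemma CmeasX k n : Cmeas k -> Cmeas (fun x => k x ^+ n).
Proof.
move=> kc; elim: n => [|n IH]; first exact: Cmeas_cst.
by under eq_fun do rewrite exprS; exact: CmeasM.
Qed.

Lemma measurable_inv_ge0 (k : T -> R) : (forall x, 0 <= k x) ->
  measurable_fun setT k -> measurable_fun setT (fun x => (k x)^-1).
Proof.
move=> k0 mk; rewrite (_ : (fun _ => _) = (fun x => k x `^ (-1))).
  exact: (measurableT_comp (measurable_powR _)).
by apply/funext => x; rewrite powR_inv1.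
Qed.

Lemma measurable_nsq k : Cmeas k -> measurable_fun setT (fun x => nsq (k x)).
Proof.
by move=> [k1 k2]; apply: measurable_funD; exact: measurable_funX.
Qed.

Lemma CmeasV k : Cmeas k -> Cmeas (fun x => (k x)^-1).
Proof.
move=> kc; have [k1 k2] := kc.
have mi := measurable_inv_ge0 (fun x => nsq_ge0 (k x)) (measurable_nsq kc).
split.
  by under eq_fun do rewrite complex_ReV; exact: measurable_funM.
by under eq_fun do rewrite complex_ImV; apply: measurable_funN; exact: measurable_funM.
Qed.

Lemma Cmeas_cexp k : Cmeas k -> Cmeas (fun x => cexp (k x)).
Proof.
move=> [k1 k2].
have me : measurable_fun setT (fun x => expR (complex.Re (k x))).
  exact: (measurableT_comp (@measurable_expR R)).
split.
  under eq_fun do rewrite /cexp complex_ReZ /=.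
  apply: measurable_funM => //; apply: (measurableT_comp _ k2).
  by apply: continuous_measurable_fun; exact: continuous_cos.
under eq_fun do rewrite /cexp complex_ImZ /=.
apply: measurable_funM => //; apply: (measurableT_comp _ k2).
by apply: continuous_measurable_fun; exact: continuous_sin.
Qed.

Lemma Lfun2_sqr (k : T -> R) : measurable_fun setT k ->
  (\int[mu]_x (k x ^+ 2)%:E < +oo)%E -> k \in Lfun mu 2%:E.
Proof.
move=> mk ik; apply/andP; split; rewrite inE//=.
rewrite /finite_norm unlock /= poweR_lty//.
apply: le_lt_trans ik; apply: ge0_le_integral => //.
- apply/measurable_EFinP; apply: (measurableT_comp (measurable_powR 2)).
  exact: measurableT_comp.
- by apply/measurable_EFinP; exact: measurable_funX.
- by move=> x _; rewrite lee_fin powR_mulrn// real_normK// num_real.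
Qed.

Lemma L2predP (k : T -> R[i]) :
  k \in L2pred mu <-> Cmeas k /\ (\int[mu]_x (nsq (k x))%:E < +oo)%E.
Proof.
split=> [/andP[/= k1 k2]|[[k1 k2] ik]].
  have i1 := Lfun2_integrable_sqr k1; have i2 := Lfun2_integrable_sqr k2.
  split.
    by move: k1 k2 => /andP[+ _] /andP[+ _]; rewrite !inE.
  have := integrableD measurableT i1 i2 => /integrableP[_].
  apply: le_lt_trans; apply: ge0_le_integral => //.
  - by move=> x _; rewrite lee_fin nsq_ge0.
  - apply/measurable_EFinP/measurable_nsq.
    by move: k1 k2 => /andP[+ _] /andP[+ _]; rewrite !inE.
  - apply: measurableT_comp => //.
    by apply: emeasurable_funD; apply: (measurable_int mu).
  - by move=> x _ /=; rewrite lee_fin ger0_norm// addr_ge0// sqr_ge0.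
apply/andP; split; apply: Lfun2_sqr => //; apply: le_lt_trans ik;
  apply: ge0_le_integral => //.
- by move=> x _; rewrite lee_fin sqr_ge0.
- by apply/measurable_EFinP; exact: measurable_funX.
- by apply/measurable_EFinP/measurable_nsq.
- by move=> x _; rewrite lee_fin lerDl sqr_ge0.
- by move=> x _; rewrite lee_fin sqr_ge0.
- by apply/measurable_EFinP; exact: measurable_funX.
- by apply/measurable_EFinP/measurable_nsq.
- by move=> x _; rewrite lee_fin lerDr sqr_ge0.
Qed.

Lemma Cmeas_L2 f : Cmeas f.
Proof. by have /L2predP[] := L2valP (repr f). Qed.

Lemma normsqE f : (normsq f)%:E = (\int[mu]_x (nsq (f x))%:E)%E.
Proof.
have [i1 i2] := Cintegrable_dot f f.
rewrite /normsq /L2dot /= /Rintegral fineK; last exact: integrable_fin_num.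
by apply: eq_integral => x _; rewrite nsq_conj.
Qed.

Lemma integrable_nsq f : mu.-integrable setT (fun x => (nsq (f x))%:E).
Proof.
have [i1 i2] := Cintegrable_dot f f.
by apply: eq_integrable i1 => // x _ /=; rewrite nsq_conj.
Qed.

(** The functions by which multiplication is a bounded operator of [L2]. *)
Definition bmul (k : T -> R[i]) := Cmeas k /\ exists C : R, forall x, nsq (k x) <= C.

Lemma bmul_L2pred k f : bmul k -> (fun x => k x * f x) \in L2pred mu.
Proof.
move=> [mk [C kC]]; apply/L2predP; split.
  by apply: CmeasM => //; exact: Cmeas_L2.
have i1 := integrableZl measurableT C (integrable_nsq f).
have := i1 => /integrableP[_]; apply: le_lt_trans; apply: ge0_le_integral => //.
- by move=> x _; rewrite lee_fin nsq_ge0.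
- by apply/measurable_EFinP/measurable_nsq/CmeasM => //; exact: Cmeas_L2.
- by apply: measurableT_comp => //; apply: (measurable_int mu i1).
- move=> x _ /=; rewrite lee_fin nsqM; apply: le_trans (ler_norm _).
  by rewrite ler_wpM2r// nsq_ge0.
Qed.

Lemma L2mulE k f : bmul k -> {ae mu, forall x, L2mul k f x = k x * f x}.
Proof. by move=> /bmul_L2pred kf; exact: toL2E. Qed.

End SquareNorm.

Section Multiplication.
Context d (T : measurableType d) (R : realType) (mu : {measure set T -> \bar R}).
Implicit Types (f g h : L2 mu) (k l : T -> R[i]).

Lemma L2DE f g : {ae mu, forall x, (f + g : L2 mu) x = f x + g x}.
Proof. by have := L2ZDE 1 f g; rewrite scale1r; apply: filterS => x ->; rewrite mul1r. Qed.

Lemma L2ZE a f : {ae mu, forall x, (a *: f : L2 mu) x = a * f x}.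
Proof.
have := L2ZDE a f 0; rewrite addr0; apply: filterS2 (L2zero _) => x -> ->.
by rewrite addr0.
Qed.

Lemma L2BE f g : {ae mu, forall x, (f - g : L2 mu) x = f x - g x}.
Proof.
have := L2DE f (- g); have := L2ZE (-1) g; apply: filterS2 => x.
by rewrite scaleN1r => -> ->; rewrite mulN1r.
Qed.

Lemma bmul_cst (c : R[i]) : bmul (fun _ : T => c).
Proof. by split; [exact: Cmeas_cst|exists (nsq c)]. Qed.

Lemma bmulD k l : bmul k -> bmul l -> bmul (fun x => k x + l x).
Proof.
move=> [mk [C kC]] [ml [C' lC]]; split; first exact: CmeasD.
exists (2 * C + 2 * C') => x; apply: le_trans (nsqD_le _ _) _.
by rewrite lerD// ler_pM2l.
Qed.

Lemma bmulM k l : bmul k -> bmul l -> bmul (fun x => k x * l x).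
Proof.
move=> [mk [C kC]] [ml [C' lC]]; split; first exact: CmeasM.
by exists (C * C') => x; rewrite nsqM; apply: ler_pM; rewrite ?nsq_ge0.
Qed.

Lemma bmulB k l : bmul k -> bmul l -> bmul (fun x => k x - l x).
Proof.
move=> bk bl; rewrite (_ : (fun _ => _) = (fun x => k x + (-1) * l x)).
  by apply: bmulD => //; apply: bmulM => //; exact: bmul_cst.
by apply/funext => x; rewrite mulN1r.
Qed.

Lemma bmulX k n : bmul k -> bmul (fun x => k x ^+ n).
Proof.
move=> bk; elim: n => [|n IH]; first exact: bmul_cst.
by under eq_fun do rewrite exprS; exact: bmulM.
Qed.

Lemma bmul_sum (I : Type) (r : seq I) (F : I -> T -> R[i]) :
  (forall i, bmul (F i)) -> bmul (fun x => \sum_(i <- r) F i x).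
Proof.
move=> Fc; elim: r => [|i r IH].
  by under eq_fun do rewrite big_nil; exact: bmul_cst.
by under eq_fun do rewrite big_cons; exact: bmulD.
Qed.

Lemma L2mul_lin k a f g : bmul k ->
  L2mul k (a *: f + g) = a *: L2mul k f + L2mul k g :> L2 mu.
Proof.
move=> bk; apply/L2P.
have E1 := L2mulE (a *: f + g) bk; have E2 := L2mulE f bk; have E3 := L2mulE g bk.
have E4 := L2ZDE a (L2mul k f) (L2mul k g); have E5 := L2ZDE a f g.
apply: filterS (filterI E1 (filterI E2 (filterI E3 (filterI E4 E5)))) => x [e1 [e2 [e3 [e4 e5]]]].
by rewrite e1 e4 e2 e3 e5 mulrDr mulrCA.
Qed.

Lemma L2mulM k l f : bmul k -> bmul l ->
  L2mul (fun x => k x * l x) f = L2mul k (L2mul l f) :> L2 mu.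
Proof.
move=> bk bl; apply/L2P.
have E1 := L2mulE f (bmulM bk bl); have E2 := L2mulE f bl.
have E3 := L2mulE (L2mul l f) bk.
apply: filterS (filterI E1 (filterI E2 E3)) => x [e1 [e2 e3]].
by rewrite e1 e3 e2 mulrA.
Qed.

Lemma L2mulD k l f : bmul k -> bmul l ->
  L2mul (fun x => k x + l x) f = L2mul k f + L2mul l f :> L2 mu.
Proof.
move=> bk bl; apply/L2P.
have E1 := L2mulE f (bmulD bk bl); have E2 := L2mulE f bl.
have E3 := L2mulE f bk; have E4 := L2DE (L2mul k f) (L2mul l f).
apply: filterS (filterI E1 (filterI E2 (filterI E3 E4))) => x [e1 [e2 [e3 e4]]].
by rewrite e1 e4 e2 e3 mulrDl.
Qed.

Lemma L2mul_cst (c : R[i]) f : L2mul (fun=> c) f = c *: f :> L2 mu.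
Proof.
apply/L2P; have E1 := L2mulE f (bmul_cst c); have E2 := L2ZE c f.
apply: filterS (filterI E1 E2) => x [e1 e2].
by rewrite e1 e2.
Qed.

Lemma L2mulB k l f : bmul k -> bmul l ->
  L2mul (fun x => k x - l x) f = L2mul k f - L2mul l f :> L2 mu.
Proof.
move=> bk bl; apply/L2P.
have E1 := L2mulE f (bmulB bk bl); have E2 := L2mulE f bl.
have E3 := L2mulE f bk; have E4 := L2BE (L2mul k f) (L2mul l f).
apply: filterS (filterI E1 (filterI E2 (filterI E3 E4))) => x [e1 [e2 [e3 e4]]].
by rewrite e1 e4 e2 e3 mulrBl.
Qed.

Lemma L2mul_sum (I : Type) (r : seq I) (F : I -> T -> R[i]) f :
  (forall i, bmul (F i)) ->
  L2mul (fun x => \sum_(i <- r) F i x) f = \sum_(i <- r) L2mul (F i) f :> L2 mu.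
Proof.
move=> bF; elim: r => [|i r IH].
  rewrite big_nil -[RHS](scale0r f) -L2mul_cst; congr L2mul.
  by apply/funext => x; rewrite big_nil.
rewrite big_cons -IH -L2mulD//; last exact: bmul_sum.
by congr L2mul; apply/funext => x; rewrite big_cons.
Qed.

Lemma normsq_ae f k : Cmeas k -> {ae mu, forall x, f x = k x} ->
  (normsq f)%:E = (\int[mu]_x (nsq (k x))%:E)%E.
Proof.
move=> mk fk; rewrite normsqE; apply: ae_eq_integral => //.
- by apply/measurable_EFinP/measurable_nsq; exact: Cmeas_L2.
- by apply/measurable_EFinP/measurable_nsq.
- by apply: filterS fk => x ->.
Qed.

Lemma normsq_L2mul_le k f (C : R) : Cmeas k -> (forall x, nsq (k x) <= C) ->
  normsq (L2mul k f : L2 mu) <= C * normsq f.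
Proof.
move=> mk kC; have bk : bmul k by split=> //; exists C.
have mkf := CmeasM mk (Cmeas_L2 f).
rewrite -lee_fin (normsq_ae mkf (L2mulE f bk)) EFinM normsqE.
have mf : measurable_fun setT (fun x => (nsq (f x))%:E).
  by apply/measurable_EFinP/measurable_nsq; exact: Cmeas_L2.
rewrite -(integralZl measurableT (integrable_nsq f)).
apply: ge0_le_integral => //.
- by move=> x _; rewrite lee_fin nsq_ge0.
- by apply/measurable_EFinP/measurable_nsq.
- exact: (measurable_funeM C%:E).
- by move=> x _; rewrite lee_fin nsqM ler_wpM2r// nsq_ge0.
Qed.

Definition cvgL2 (u : nat -> L2 mu) f := (fun n => normsq (u n - f)) @ \oo --> (0 : R).

Lemma cvg0_squeeze (a b : nat -> R) : (forall n, 0 <= a n <= b n) ->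
  b @ \oo --> (0 : R) -> a @ \oo --> (0 : R).
Proof.
move=> ab b0; apply: (squeeze_cvgr _ (cvg_cst (0 : R)) b0).
by apply: nearW => n; exact: ab.
Qed.

Lemma cvg0M (b : nat -> R) (c : R) : b @ \oo --> (0 : R) ->
  (fun n => c * b n) @ \oo --> (0 : R).
Proof. by move=> b0; rewrite -(mulr0 c); apply: cvgM => //; exact: cvg_cst. Qed.

Lemma cvg0D (a b : nat -> R) : a @ \oo --> (0 : R) -> b @ \oo --> (0 : R) ->
  (fun n => a n + b n) @ \oo --> (0 : R).
Proof. by move=> a0 b0; rewrite -(addr0 (0 : R)); exact: cvgD. Qed.

Lemma cvgL2D u v f g : cvgL2 u f -> cvgL2 v g -> cvgL2 (fun n => u n + v n) (f + g).
Proof.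
move=> uf vg; apply: (cvg0_squeeze _ (cvg0D (cvg0M 2 uf) (cvg0M 2 vg))) => n.
by rewrite normsq_ge0 opprD addrACA normsqD_le.
Qed.

Lemma cvgL2_unique u f g : cvgL2 u f -> cvgL2 u g -> f = g.
Proof.
move=> uf ug; apply/eqP; rewrite -subr_eq0; apply/eqP/normsq_eq0.
have h : (fun=> normsq (f - g)) @ \oo --> (0 : R).
  apply: (cvg0_squeeze _ (cvg0D (cvg0M 2 uf) (cvg0M 2 ug))) => n.
  rewrite normsq_ge0 -(normsqN (u n - f)) opprB.
  by rewrite (_ : f - g = (f - u n) + (u n - g)) ?normsqD_le// addrA subrK.
exact: (cvg_unique _ (cvg_cst _) h).
Qed.

(** Dominated convergence: a bounded sequence of multipliers that converges
    almost everywhere converges strongly. *)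
Lemma L2mul_cvg (k : nat -> T -> R[i]) l f (C : R) :
  (forall n, Cmeas (k n)) -> (forall n x, nsq (k n x) <= C) -> bmul l ->
  {ae mu, forall x, ccvg (fun n => k n x) (l x)} ->
  cvgL2 (fun n => L2mul (k n) f) (L2mul l f).
Proof.
move=> mk kC bl kl; have [ml [C' lC]] := bl.
have bk n : bmul (k n) by split=> //; exists C.
have mD n : Cmeas (fun x => (k n x - l x) * f x).
  by apply: CmeasM; [exact: CmeasB|exact: Cmeas_L2].
have E n : (normsq (L2mul (k n) f - L2mul l f))%:E
    = (\int[mu]_x (nsq ((k n x - l x) * f x))%:E)%E.
  rewrite -L2mulB//; apply: normsq_ae => //.
  exact: (L2mulE f (bmulB (bk n) bl)).
have ig := integrableZl measurableT (2 * C + 2 * C') (integrable_nsq f).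
have mF n : measurable_fun setT (fun x => (nsq ((k n x - l x) * f x))%:E).
  by apply/measurable_EFinP/measurable_nsq.
have cF : {ae mu, forall x, setT x ->
    (fun n => (nsq ((k n x - l x) * f x))%:E) @ \oo --> 0%E}.
  apply: filterS kl => x /ccvg_nsq kx _; apply: cvg_EFin; first exact: nearW.
  rewrite -[X in _ --> X](mul0r (nsq (f x))) /comp/=.
  under eq_fun do rewrite nsqM.
  by apply: cvgM => //; exact: cvg_cst.
have bF : {ae mu, forall x, forall n, setT x ->
    (`|(nsq ((k n x - l x) * f x))%:E| <= (2 * C + 2 * C')%:E * (nsq (f x))%:E)%E}.
  apply: aeW => x n _; rewrite lee_fin ger0_norm ?nsq_ge0// nsqM.
  rewrite ler_wpM2r ?nsq_ge0// (le_trans (nsqD_le _ _))// nsqN.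
  by rewrite lerD// ler_pM2l.
have [_ _ h] := dominated_convergence measurableT mF (measurable_cst 0%E) cF ig bF.
move: h; rewrite integral0 => /fine_cvg; apply: cvg_trans; apply: near_eq_cvg.
by apply: nearW => n /=; rewrite -E.
Qed.

(** By Fatou's lemma, the distance between the two limits is 0. Dominated
    convergence would not apply to the sums over the poles, which are not
    uniformly bounded near the point 1 of the circle. *)
Lemma cvgL2_ae_unique (u : nat -> L2 mu) f (h : T -> R[i]) : Cmeas h ->
  cvgL2 u f -> {ae mu, forall x, ccvg (fun n => u n x) (h x)} ->
  {ae mu, forall x, f x = h x}.
Proof.
move=> mh uf uh.
pose F n x := (nsq (u n x - f x))%:E.
have mu_ n : Cmeas (fun x => u n x - f x) by apply: CmeasB; exact: Cmeas_L2.
have mF n : measurable_fun setT (F n).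
  by apply/measurable_EFinP/measurable_nsq.
have F0 n x : setT x -> (0 <= F n x)%E by rewrite lee_fin nsq_ge0.
have := fatou mu measurableT mF F0.
have -> : (fun n => \int[mu]_x F n x)%E = (fun n => (normsq (u n - f))%:E).
  by apply/funext => n; rewrite (normsq_ae (mu_ n))//; exact: L2BE.
have c0 : (fun n => (normsq (u n - f))%:E) @ \oo --> 0%E.
  by apply: cvg_EFin; first exact: nearW.
rewrite (cvg_limn_einf_sup c0).1 => i0.
have mhf : Cmeas (fun x => h x - f x) by apply: CmeasB => //; exact: Cmeas_L2.
have mH : measurable_fun setT (fun x => (nsq (h x - f x))%:E).
  by apply/measurable_EFinP/measurable_nsq.
have mE : measurable_fun setT (fun x => limn_einf (F ^~ x)).
  rewrite /limn_einf; apply: measurableT_comp => //.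
  by apply: measurable_fun_limn_esup => n; apply: measurableT_comp.
have eF : ae_eq mu setT (fun x => limn_einf (F ^~ x)) (fun x => (nsq (h x - f x))%:E).
  apply: filterS uh => x ux _.
  have cx : F ^~ x @ \oo --> (nsq (h x - f x))%:E.
    apply: cvg_EFin; first exact: nearW.
    rewrite /nsq -normc_sqr expr2 /F /comp/=.
    have cn := ccvg_normc (ccvgB ux (ccvg_cst (f x))).
    under eq_fun do rewrite /nsq -normc_sqr expr2.
    exact: cvgM.
  by rewrite (cvg_limn_einf_sup cx).1.
rewrite (ae_eq_integral (fun x => (nsq (h x - f x))%:E)) // in i0.
have j0 : (\int[mu]_x `|(nsq (h x - f x))%:E| = 0)%E.
  apply/eqP; rewrite eq_le integral_ge0// andbT.
  by under eq_integral do rewrite gee0_abs ?lee_fin ?nsq_ge0//.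
have := (ae_eq_integral_abs mu measurableT mH).1 j0.
apply: filterS => x /(_ I) [] /nsq_eq0/eqP; rewrite subr_eq0 => /eqP ->.
by [].
Qed.

End Multiplication.

(** * Bounded operators and their adjoints *)

Section BoundedOperators.
Context d (T : measurableType d) d' (T' : measurableType d') (R : realType).
Variables (mu : {measure set T -> \bar R}) (nu : {measure set T' -> \bar R}).

(** For maps that are not given with a linear structure, such as adjoints and
    composites. *)
Definition blin (A : L2 mu -> L2 nu) :=
  (forall a f g, A (a *: f + g) = a *: A f + A g) /\
  exists2 M : R, 0 < M & forall f, normsq (A f) <= M * normsq f.

Lemma blinD A f g : blin A -> A (f + g) = A f + A g.
Proof. by move=> [A1 _]; have := A1 1 f g; rewrite !scale1r. Qed.

Lemma blin0 A : blin A -> A 0 = 0.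
Proof. by move=> bA; apply: (addrI (A 0)); rewrite -blinD// !addr0. Qed.

Lemma blinZ A a f : blin A -> A (a *: f) = a *: A f.
Proof. by move=> bA; have := bA.1 a f 0; rewrite (blin0 bA) !addr0. Qed.

Lemma blinN A f : blin A -> A (- f) = - A f.
Proof. by move=> bA; rewrite -scaleN1r blinZ// scaleN1r. Qed.

Lemma blinB A f g : blin A -> A (f - g) = A f - A g.
Proof. by move=> bA; rewrite blinD// blinN. Qed.

Lemma blin_sum A (I : Type) (r : seq I) (F : I -> L2 mu) : blin A ->
  A (\sum_(i <- r) F i) = \sum_(i <- r) A (F i).
Proof.
move=> bA; elim: r => [|i r IH]; first by rewrite !big_nil blin0.
by rewrite !big_cons blinD// IH.
Qed.

Lemma cvgL2_blin A u f : blin A -> cvgL2 u f -> cvgL2 (fun n => A (u n)) (A f).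
Proof.
move=> bA uf; have [_ [M M0 AM]] := bA; apply: (cvg0_squeeze _ (cvg0M M uf)) => n.
by rewrite normsq_ge0 -blinB// AM.
Qed.

Lemma blin_bounded (A : {linear L2 mu -> L2 nu}) : bounded_op A -> blin A.
Proof.
move=> [M AM]; split; first by move=> a f g; rewrite linearP.
exists (M ^+ 2 + 1); first by rewrite ltr_wpDl// sqr_ge0.
move=> f; have : normsq (A f) <= M ^+ 2 * normsq f.
  rewrite -lecR -L2norm_sqr rmorphM /= rmorphXn /= -L2norm_sqr -exprMn.
  by rewrite !expr2 ler_pM.
by move=> /le_trans; apply; rewrite mulrDl mul1r lerDl normsq_ge0.
Qed.

Lemma blin_isometry (A : {linear L2 mu -> L2 nu}) :
  isometry (@L2dot _ _ R nu) (@L2dot _ _ R mu) A -> blin A.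
Proof.
move=> iA; split; first by move=> a f g; rewrite linearP.
by exists 1 => // f; rewrite mul1r /normsq iA.
Qed.

Lemma L2dot_inj (x y : L2 mu) : (forall f, L2dot x f = L2dot y f) -> x = y.
Proof.
move=> xy; apply/eqP; rewrite -subr_eq0; apply/eqP/normsq_eq0.
by rewrite /normsq L2dotDl L2dotNl xy subrr.
Qed.

End BoundedOperators.

(** For the bound, expand [0 <= |M g - A A' g|^2] and use
    [|A' g|^2 = Re <g, A A' g>]. *)
Lemma blin_adjoint d (T : measurableType d) d' (T' : measurableType d')
  (R : realType) (mu : {measure set T -> \bar R}) (nu : {measure set T' -> \bar R})
  (A : L2 mu -> L2 nu) (A' : L2 nu -> L2 mu) : blin A -> adjoint A A' -> blin A'.
Proof.
move=> bA aA; have E g f : L2dot (A' g) f = L2dot g (A f) by have := aA f g; rewrite /inner => ->.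
split.
  by move=> a f g; apply: L2dot_inj => h; rewrite E !(L2dotDl, L2dotZl) !E.
have [_ [M M0 AM]] := bA; exists M => // g.
have h1 : normsq (A' g) = complex.Re (L2dot g (A (A' g))) by rewrite -E.
have h2 := AM (A' g).
have h3 := normsq_ge0 (M%:C *: g - A (A' g)).
have h4 : normsq (M%:C *: g - A (A' g)) =
    M ^+ 2 * normsq g - 2 * M * normsq (A' g) + normsq (A (A' g)).
  rewrite h1 /normsq !(L2dotDl, L2dotDr, L2dotZl, L2dotZr, L2dotNl, L2dotNr).
  rewrite (L2dotC (A (A' g)) g).
  move: (L2dot g g) (L2dot g _) (L2dot (A _) _) => [a1 a2] [b1 b2] [c1 c2] /=.
  ring.
rewrite h4 in h3.
have h5 : 0 <= M * (M * normsq g - normsq (A' g)) by lra.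
by move: h5; rewrite pmulr_rge0// subr_ge0.
Qed.

Lemma blin_comp d1 (T1 : measurableType d1) d2 (T2 : measurableType d2)
  d3 (T3 : measurableType d3) (R : realType)
  (m1 : {measure set T1 -> \bar R}) (m2 : {measure set T2 -> \bar R})
  (m3 : {measure set T3 -> \bar R}) (A : L2 m2 -> L2 m3) (B : L2 m1 -> L2 m2) :
  blin A -> blin B -> blin (A \o B).
Proof.
move=> bA bB; split; first by move=> a f g /=; rewrite bB.1 bA.1.
have [_ [M M0 AM]] := bA; have [_ [N N0 BN]] := bB.
exists (M * N); first exact: mulr_gt0.
by move=> f /=; apply: le_trans (AM _) _; rewrite -mulrA ler_pM2l.
Qed.

Lemma blin_L2mul d (T : measurableType d) (R : realType)
  (mu : {measure set T -> \bar R}) (k : T -> R[i]) :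
  bmul k -> blin (L2mul k : L2 mu -> L2 mu).
Proof.
move=> bk; split; first by move=> a f g; exact: L2mul_lin.
have [mk [C kC]] := bk; exists (`|C| + 1); first by rewrite ltr_wpDl.
move=> f; apply: (normsq_L2mul_le _ mk) => x.
by rewrite (le_trans (kC x))// ler_wpDr// ler_norm.
Qed.

(** Polarization: the form [D] below vanishes on the diagonal, hence everywhere,
    as is seen on [g + f] and on [i g + f]. *)
Lemma positive_selfadjoint d (T : measurableType d) (R : realType)
  (mu : {measure set T -> \bar R}) (B : {linear L2 mu -> L2 mu}) :
  positive_op B -> forall f g, L2dot (B f) g = L2dot f (B g).
Proof.
move=> pB.
pose D f g := L2dot (B f) g - L2dot f (B g).
have D0 f : D f f = 0.
  have /ger0_real/CrealP h := pB f; rewrite /inner in h.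
  by rewrite /D [L2dot f _]L2dotC h subrr.
have Dlin a f g h : D (a *: f + g) h = a * D f h + D g h.
  by rewrite /D linearP !(L2dotDl, L2dotZl, L2dotDr, L2dotZr); ring.
have Danti a f g h : D h (a *: f + g) = a^* * D h f + D h g.
  by rewrite /D linearP !(L2dotDl, L2dotZl, L2dotDr, L2dotZr); ring.
move=> f g; apply/eqP; rewrite -subr_eq0 -/(D f g); apply/eqP.
have Dexp a : a^* * D f g + a * D g f = 0.
  have := D0 (a *: g + f); rewrite Dlin !Danti !D0 !mulr0 add0r addr0 => <-.
  by ring.
have h1 := Dexp 1; have hi := Dexp 'i.
rewrite rmorph1 !mul1r in h1; rewrite conjCi mulNr addrC -mulrBr in hi.
have i0 : 'i != 0 :> R[i] by rewrite neq0Ci.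
move/eqP: hi; rewrite mulf_eq0 (negbTE i0) /= subr_eq0 => /eqP hi.
by move/eqP: h1; rewrite hi -mulr2n mulrn_eq0 /= => /eqP.
Qed.

Lemma adjointE d (T : measurableType d) d' (T' : measurableType d') (R : realType)
  (mu : {measure set T -> \bar R}) (nu : {measure set T' -> \bar R})
  (A : L2 mu -> L2 nu) (A' : L2 nu -> L2 mu) :
  adjoint A A' -> forall f g, L2dot (A' g) f = L2dot g (A f).
Proof. by move=> aA f g; have := aA f g; rewrite /inner => ->. Qed.

(** * Coordinates of square-summable families *)

Section SquareSummable.
Context d (I : measurableType d) (R : realType).
Hypothesis measurableI : forall A : set I, measurable A.
Implicit Types (f g : L2 (@counting_measure.counting I R)) (k : I -> R[i]).
Local Notation counting := (@counting I R).

Lemma ae_counting (P : I -> Prop) : {ae counting, forall x, P x} -> forall x, P x.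
Proof.
move=> [N [_ + PN]] x; rewrite /counting; case: ifPn => // /asboolP finN.
move=> /eqP; rewrite eqe pnatr_eq0 finmap.cardfs_eq0 => /eqP/fset_set_set0 N0.
by apply: contrapT => Px; have := PN x Px; rewrite N0.
Qed.

Lemma Cmeas_discrete k : Cmeas k.
Proof. by split=> _ A _; exact: measurableI. Qed.

Lemma integral_discrete1 (h : I -> R) n : (forall x, x != n -> h x = 0) ->
  \int[counting]_x h x = h n.
Proof.
move=> h0; rewrite /Rintegral.
have -> : (\int[counting]_x (h x)%:E = \int[counting]_(x in [set n]) (h x)%:E)%E.
  rewrite [RHS]integral_mkcond; apply: eq_integral => x _.
  rewrite patchE; case: ifPn => // /negP xn; rewrite h0//.
  by apply/eqP => xE; apply: xn; rewrite xE inE.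
rewrite (eq_integral (cst (h n)%:E)); last by move=> x /[!inE] ->.
have c1 : counting [set n] = 1%E.
  by rewrite /counting asboolT ?fset_set1 ?finmap.cardfs1.
rewrite integral_cst//.
by rewrite [X in (_ * X)%E]c1 mule1.
Qed.

Lemma L2pred_finite_support (k : I -> R[i]) (s : seq I) : 
  (forall x, x \notin s -> k x = 0) -> k \in L2pred counting.
Proof.
move=> k0; apply/L2predP; split; first exact: Cmeas_discrete.
pose c := \sum_(n <- s) nsq (k n).
have c0 : 0 <= c by apply: sumr_ge0 => n _; exact: nsq_ge0.
have fs : finite_set [set` s] by exact: finite_seq.
have -> : (\int[counting]_x (nsq (k x))%:E = \int[counting]_(x in [set` s]) (nsq (k x))%:E)%E.
  rewrite [RHS]integral_mkcond; apply: eq_integral => x _.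
  rewrite patchE; case: ifPn => // xs; rewrite k0 ?/nsq/= ?expr0n ?addr0//.
  by apply: contra xs => xs; rewrite inE.
apply: (@le_lt_trans _ _ (\int[counting]_(x in [set` s]) c%:E)%E).
  apply: ge0_le_integral => //.
  - by move=> x _; rewrite lee_fin nsq_ge0.
  - move=> x /= xs; rewrite lee_fin /c (perm_big _ (perm_to_rem xs)) big_cons.
    by rewrite lerDl sumr_ge0// => n _; exact: nsq_ge0.
have cs : (counting [set` s] < +oo)%E by rewrite /counting asboolT// ltry.
rewrite integral_cst//.
by apply: lte_mul_pinfty => //; rewrite lee_fin.
Qed.

Lemma deltaE n x : (delta R n : L2 counting) x = (x == n)%:R.
Proof.
move: x; apply: ae_counting; apply: toL2E; apply: (@L2pred_finite_support _ [:: n]) => x.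
by rewrite inE => /negbTE ->.
Qed.

Lemma L2dot_delta f n : L2dot f (delta R n) = f n.
Proof.
have E x : f x * ((delta R n : L2 counting) x)^* = f n * (x == n)%:R.
  by rewrite deltaE rmorph_nat; case: eqP => [->//|_]; rewrite !mulr0.
apply/eqP; rewrite eq_complex /L2dot /Cintegral /=; apply/andP; split; apply/eqP.
  rewrite (@integral_discrete1 _ n) => [|x /negbTE xn]; rewrite E ?xn ?mulr0//.
  by rewrite eqxx mulr1.
rewrite (@integral_discrete1 _ n) => [|x /negbTE xn]; rewrite E ?xn ?mulr0//.
by rewrite eqxx mulr1.
Qed.

Lemma ell2P f g : (forall x, f x = g x) -> f = g.
Proof. by move=> fg; apply/L2P; exact: aeW. Qed.

Lemma L2mul_discreteE k f x : bmul k -> L2mul k f x = k x * f x.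
Proof. by move=> bk; move: x; apply: ae_counting; exact: L2mulE. Qed.

Lemma sum_deltaE (s : seq I) f : uniq s ->
  \sum_(n <- s) f n *: delta R n = L2mul (fun x => (x \in s)%:R) f.
Proof.
move=> us.
have b1 n : bmul (fun x : I => ((x == n)%:R : R[i])).
  split; first exact: Cmeas_discrete.
  by exists 1 => x; rewrite /nsq; case: eqP; rewrite /= ?expr1n ?expr0n/= ?addr0//.
have -> : L2mul (fun x => (x \in s)%:R) f = L2mul (fun x => \sum_(n <- s) (x == n)%:R) f.
  congr L2mul; apply/funext => x; rewrite -natr_sum -count_uniq_mem//.
  rewrite -sum1_count big_mkcond; congr (_%:R); apply: eq_bigr => n _ /=.
  by rewrite eq_sym; case: eqP.
rewrite L2mul_sum//; apply: eq_bigr => n _; apply: ell2P => x.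
rewrite L2mul_discreteE//.
have -> : (f n *: delta R n : L2 counting) x = f n * (delta R n : L2 counting) x.
  by move: x; apply: ae_counting; exact: L2ZE.
by rewrite deltaE mulrC; case: eqP => [->//|_]; rewrite !mul0r.
Qed.

(** The partial sum over [s N] is the product with the indicator function of
    [s N], so that dominated convergence applies. *)
Lemma cvgL2_sum_delta (s : nat -> seq I) f : (forall N, uniq (s N)) ->
  (forall x, \forall N \near \oo, x \in s N) ->
  cvgL2 (fun N => \sum_(n <- s N) f n *: delta R n) f.
Proof.
move=> us sx; rewrite /cvgL2; under eq_fun do rewrite sum_deltaE//.
suff : cvgL2 (fun N => L2mul (fun x => (x \in s N)%:R) f) (L2mul (fun=> 1) f).
  by rewrite L2mul_cst scale1r.
apply: (@L2mul_cvg _ _ _ _ _ _ _ 1).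
- by move=> n; exact: Cmeas_discrete.
- by move=> n x; rewrite /nsq; case: (x \in _); rewrite /= ?expr1n ?expr0n/= ?addr0.
- exact: bmul_cst.
- apply: aeW => x; split => /=; apply: cvg_near_cst.
    by apply: filterS (sx x) => N ->.
  by apply: filterS (sx x) => N ->.
Qed.

End SquareSummable.

Section DeltaExpansion.
Variable R : realType.
Local Notation l2N := (L2 (@counting_measure.counting nat R)).
Local Notation l2Z := (L2 (@counting_measure.counting int R)).

Lemma cvgL2_sum_delta_nat (f : l2N) :
  cvgL2 (fun N => \sum_(n <- iota 0 N) f n *: (delta R n : l2N)) f.
Proof.
apply: cvgL2_sum_delta => // [N|x]; first exact: iota_uniq.
by near=> N; rewrite mem_iota add0n leq0n/=; near: N; exact: nbhs_infty_gt.
Unshelve. all: by end_near. Qed.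

Lemma cvgL2_sum_delta_int (f : l2Z) :
  cvgL2 (fun N => \sum_(j < N.*2.+1) f (j%:Z - N%:Z) *: (delta R (j%:Z - N%:Z) : l2Z)) f.
Proof.
have mI : forall A : set int, measurable A by [].
have := @cvgL2_sum_delta _ _ R mI
  (fun N => [seq j%:Z - N%:Z | j <- iota 0 N.*2.+1]) f.
rewrite (_ : (fun N => \sum_(n <- _) _) = (fun N => \sum_(j < N.*2.+1)
  f (j%:Z - N%:Z) *: (delta R (j%:Z - N%:Z) : l2Z))); last first.
  apply/funext => N; rewrite big_map.
  by rewrite -(big_mkord xpredT
    (fun j => f (j%:Z - N%:Z) *: (delta R (j%:Z - N%:Z) : l2Z))) /index_iota subn0.
apply=> [N|x].
  by rewrite map_inj_uniq ?iota_uniq// => i j /addIr [].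
near=> N; apply/mapP; exists (absz ((x : int) + N%:Z)%R).
  rewrite mem_iota/=; have : (absz (x : int) < N)%N by near: N; exact: nbhs_infty_gt.
  lia.
have : (absz (x : int) < N)%N by near: N; exact: nbhs_infty_gt.
lia.
Unshelve. all: by end_near. Qed.

Lemma delta_eq d (T : measurableType d) (nu : {measure set T -> \bar R})
  (A B : l2N -> L2 nu) : blin A -> blin B ->
  (forall n : nat, A (delta R n) = B (delta R n)) -> A =1 B.
Proof.
move=> bA bB AB f; have h := cvgL2_sum_delta_nat f.
apply: (cvgL2_unique (cvgL2_blin bA h)).
rewrite (_ : (fun N => A _) = fun N =>
  B (\sum_(n <- iota 0 N) f n *: (delta R n : l2N))); first exact: cvgL2_blin.
apply/funext => N; rewrite !blin_sum//; apply: eq_bigr => n _.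
by rewrite !blinZ// AB.
Qed.

End DeltaExpansion.

(** * The poles [xp n] and the vectors [zeta n] *)

Section Zeta.
Variables (R : realType) (p : nat).
Hypothesis p_gt1 : (1 < p)%N.
Local Notation logp := (ln (p%:R : R)).
Implicit Types (n : int) (k : nat).

Lemma logp_gt0 : 0 < logp.
Proof. by rewrite ln_gt0// ltr1n. Qed.

Definition zeta_den n : R[i] := (4 * pi * n%:~R) +i* (3 * logp).

Lemma complex_rect (a b : R) : a +i* b = a%:C + 'i * b%:C.
Proof. by rewrite -complexiE; exact: complexE. Qed.

Lemma zeta_denE n : 4 * pi%:C * n%:~R + 3 * 'i * logp%:C = zeta_den n.
Proof.
by rewrite /zeta_den complex_rect !rmorphM /= !rmorph_nat rmorph_int; ring.
Qed.

Lemma xpE n : xp R p n = ((4 * pi * n%:~R) -i* logp) / zeta_den n.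
Proof.
rewrite /xp zeta_denE; congr (_ / _).
by rewrite complex_rect !rmorphM /= !rmorph_nat rmorph_int rmorphN /=; ring.
Qed.

Lemma zeta_den_neq0 n : zeta_den n != 0.
Proof.
apply/eqP => /(congr1 (@complex.Im R)) /= /eqP.
by rewrite mulf_eq0 pnatr_eq0 /= gt_eqF// logp_gt0.
Qed.

Lemma nsq_zeta_den n : 0 < nsq (zeta_den n).
Proof.
rewrite lt_def nsq_ge0 andbT; apply/eqP => /nsq_eq0/eqP.
by rewrite (negbTE (zeta_den_neq0 n)).
Qed.

Lemma nsqV (z : R[i]) : nsq z^-1 = (nsq z)^-1.
Proof.
have [->|z0] := eqVneq z 0; first by rewrite invr0 /nsq /= expr0n /= addr0 invr0.
have nz : nsq z != 0 by apply: contra_neq z0; exact: nsq_eq0.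
apply: (mulfI nz); rewrite -nsqM mulfV// mulfV// /nsq /= expr1n expr0n addr0//.
Qed.

Lemma nsqX (z : R[i]) k : nsq (z ^+ k) = nsq z ^+ k.
Proof.
elim: k => [|k IH]; first by rewrite !expr0 /nsq /= expr1n expr0n addr0.
by rewrite !exprS nsqM IH.
Qed.

Lemma nsq_xp_lt1 n : nsq (xp R p n) < 1.
Proof.
rewrite xpE nsqM nsqV ltr_pdivrMr ?nsq_zeta_den// mul1r /nsq /=.
rewrite ltrD2l sqrrN exprMn ltr_pMl ?exprn_gt0 ?logp_gt0//.
by rewrite -natrX ltr1n.
Qed.

Lemma zeta_denN n : zeta_den (- n) = - (zeta_den n)^*.
Proof.
by apply/eqP; rewrite eq_complex /= rmorphN/= mulrN opprK !eqxx.
Qed.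

Lemma xpN n : xp R p (- n) = (xp R p n)^*.
Proof.
rewrite !xpE zeta_denN rmorphM fmorphV invrN mulrN -mulNr; congr (_ * _).
by apply/eqP; rewrite eq_complex /= rmorphN/= mulrN !opprK !eqxx.
Qed.

Definition zeta_coef n : R[i] :=
  (2 `^ (3 / 2) * logp `^ (1 / 2))%:C / zeta_den n.

(** With [xpN], this turns the reflection [n -> - n] of the index into complex
    conjugation, up to a sign: the origin of the negative factor [(1 - p) / p]. *)
Lemma zeta_coefN n : zeta_coef (- n) = - (zeta_coef n)^*.
Proof.
rewrite /zeta_coef zeta_denN [in RHS]rmorphM fmorphV invrN mulrN; congr (- (_ * _)).
by apply/eqP; rewrite eq_complex /= oppr0 !eqxx.
Qed.

Lemma zeta_coef_sqr n : zeta_coef n ^+ 2 = 8 * logp%:C / zeta_den n ^+ 2.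
Proof.
rewrite /zeta_coef expr_div_n; congr (_ / _); rewrite -rmorphXn exprMn /=.
have -> : (2 `^ (3 / 2)) ^+ 2 = 8 :> R.
  rewrite -powR_mulrn ?powR_ge0// -powRrM divfK//.
  by rewrite -[3]/(3%:R) powR_mulrn// -natrX.
have -> : (logp `^ (1 / 2)) ^+ 2 = logp.
  by rewrite -powR_mulrn ?powR_ge0// -powRrM divfK// powRr1// ltW// logp_gt0.
by rewrite rmorphM /= rmorph_nat.
Qed.

Lemma geometric_L2pred (b x : R[i]) : nsq x < 1 ->
  (fun k => b * x ^+ k) \in L2pred (@counting nat R).
Proof.
move=> x1; apply/L2predP; split; first exact: Cmeas_discrete.
rewrite ge0_integral_count => [|k]; last by rewrite lee_fin nsq_ge0.
have x0 : 0 <= nsq x by exact: nsq_ge0.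
have y1 : 0 < 1 - nsq x by rewrite subr_gt0.
apply: (@le_lt_trans _ _ (nsq b / (1 - nsq x))%:E); last exact: ltry.
apply: lime_le.
  by apply: is_cvg_nneseries => k _ _; rewrite lee_fin nsq_ge0.
apply: nearW => m; rewrite sumEFin lee_fin.
have -> : \sum_(0 <= k < m) nsq (b * x ^+ k) = series (geometric (nsq b) (nsq x)) m.
  by apply: eq_bigr => k _; rewrite nsqM nsqX.
rewrite geometric_seriesE ?lt_eqF//= ler_pM2r ?invr_gt0//.
by rewrite ler_piMr ?nsq_ge0// gerBl exprn_ge0.
Qed.

Lemma zetaE n k : (zeta R p n : L2 (@counting_measure.counting nat R)) k =
  zeta_coef n * xp R p n ^+ k.
Proof.
have h := toL2E (geometric_L2pred (zeta_coef n) (nsq_xp_lt1 n)).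
have := ae_counting h k; rewrite /zeta /zeta_coef -zeta_denE => <-.
by [].
Qed.

End Zeta.

(** * Functions on the circle *)

Section CircleFunctions.
Variable R : realType.
Notation normc := Normc.normc.
Local Notation arc := (@arclength R).

Lemma measurable_circle (k : circle R -> R) :
  measurable_fun setT (fun t : measurableTypeR R => k (cis t)) -> measurable_fun setT k.
Proof.
move=> mk _ A mA; rewrite setTI.
have := mk measurableT A mA; rewrite setTI.
by [].
Qed.

Lemma Cmeas_val : Cmeas (fun v : circle R => val v).
Proof.
have lin : measurable_fun setT (fun t : measurableTypeR R => 2 * pi * t : R).
  exact: measurable_funM.
split; apply: measurable_circle => /=.
  apply: (measurableT_comp _ lin).
  by apply: continuous_measurable_fun; exact: continuous_cos.
apply: (measurableT_comp _ lin).
by apply: continuous_measurable_fun; exact: continuous_sin.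
Qed.

Lemma normc_circle (v : circle R) : normc (val v) = 1.
Proof.
have /eqP := valP v; rewrite normc_def => /complexI.
by case: (val v) => a b.
Qed.

Lemma nsq_circle (v : circle R) : nsq (val v) = 1.
Proof. by rewrite /nsq -normc_sqr normc_circle expr1n. Qed.

Lemma circle_neq0 (v : circle R) : val v != 0.
Proof. by rewrite -normc_neq0 normc_circle oner_eq0. Qed.

Lemma ae_circle_neq1 : {ae arc, forall v : circle R, val v != 1}.
Proof.
pose N : set (circle R) := [set v | val v = 1].
have mN : measurable N.
  have [m1 m2] := Cmeas_val.
  rewrite (_ : N = (fun v => complex.Re (val v)) @^-1` [set 1%R] `&`
     (fun v => complex.Im (val v)) @^-1` [set 0%R]).
    apply: measurableI; rewrite -[X in measurable X]setTI; [apply: m1|apply: m2] => //;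
      exact: measurable_set1.
  apply/seteqP; split=> v /=; first by rewrite /N/= => ->.
  by rewrite /N /=; case: (val v) => a b /= [-> ->].
exists N; split=> //.
  rewrite /arclength /pushforward /mrestr.
  have -> : (@cis R) @^-1` N `&` `[0, 1[%classic = [set 0%R].
    apply/seteqP; split=> t /=.
      rewrite /N /= in_itv /= => -[te /andP[t0 t1]].
      apply/eqP; apply: contraT => tn0.
      have /expi_neq1 : 0 < 2 * pi * t < pi *+ 2.
        have tp : 0 < t by rewrite lt_def tn0.
        rewrite !mulr_gt0 ?pi_gt0//=.
        by rewrite -(mulr_natl pi 2) gtr_pMr// mulr_gt0// pi_gt0.
      by rewrite [expi _]te eqxx.
    move=> ->; rewrite /N /= in_itv/= lexx ltr01; split=> //.
    by rewrite mulr0 /expi cos0 sin0.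
  exact: lebesgue_measure_set1.
by move=> v /= /negP; rewrite negbK => /eqP.
Qed.

Lemma arclength_setT : arc setT = 1%E.
Proof.
rewrite /arclength /pushforward /mrestr preimage_setT setTI.
by rewrite lebesgue_measure_itv /= lte_fin ltr01 sube0.
Qed.

Definition vpow (n : int) (v : circle R) : R[i] := val v ^ n.

Lemma nsq_vpow n v : nsq (vpow n v) = 1.
Proof.
rewrite /vpow; case: n => n /=; last rewrite NegzE -exprnN nsqV.
  by rewrite -exprnP nsqX nsq_circle expr1n.
by rewrite nsqX nsq_circle expr1n invr1.
Qed.

Lemma Cmeas_vpow n : Cmeas (vpow n).
Proof.
rewrite /vpow; case: n => n; first by apply: CmeasX; exact: Cmeas_val.
by apply: CmeasV; apply: CmeasX; exact: Cmeas_val.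
Qed.

Lemma bmul_vpow n : bmul (vpow n).
Proof. by split; [exact: Cmeas_vpow|exists 1 => v; rewrite nsq_vpow]. Qed.

Lemma zpowE n : {ae arc, forall v, (zpow R n : L2 arc) v = vpow n v}.
Proof.
apply: toL2E; apply/L2predP; split; first exact: Cmeas_vpow.
under eq_integral do rewrite nsq_vpow.
by rewrite integral_cst// mul1e; have := arclength_setT => /= ->; rewrite ltry.
Qed.

Lemma L2mul_vpow m n : L2mul (vpow m) (zpow R n) = zpow R (m + n).
Proof.
apply/L2P.
apply: filterS (filterI (L2mulE (zpow R n) (bmul_vpow m))
  (filterI (zpowE n) (zpowE (m + n)))) => v [-> [-> ->]].
by rewrite /vpow expfzDr// circle_neq0.
Qed.

Lemma L2dot_vpow m (f g : L2S1 R) : L2dot (L2mul (vpow m) f) (L2mul (vpow m) g) = L2dot f g.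
Proof.
apply: ae_Cintegral; try exact: Cintegrable_dot.
apply: filterS (filterI (L2mulE f (bmul_vpow m)) (L2mulE g (bmul_vpow m))) => v [-> ->].
by rewrite rmorphM /= mulrACA nsq_conj nsq_vpow mul1r.
Qed.

End CircleFunctions.

(** * Geometric sums of complex numbers *)

Section GeometricSums.
Variable R : realType.
Notation normc := Normc.normc.

Lemma normcX (z : R[i]) k : normc (z ^+ k) = normc z ^+ k.
Proof.
elim: k => [|k IH]; first by rewrite !expr0 Normc.normc1.
by rewrite !exprS Normc.normcM IH.
Qed.

Lemma normc_1sub_ge (z : R[i]) : 1 - normc z <= normc (1 - z).
Proof.
rewrite lerBlDr -[X in X <= _](Normc.normc1 R) -{1}[1](subrK z).
exact: normc_triangle.
Qed.

Lemma normc_geometric_le (z : R[i]) (r : R) J : normc z <= r -> r < 1 ->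
  normc (\sum_(j < J) z ^+ j) <= (1 - r)^-1.
Proof.
move=> zr r1; have r0 : 0 <= r by exact: le_trans (normc_ge0 z) zr.
apply: le_trans (normc_sum_le _ _ _) _.
apply: (@le_trans _ _ (\sum_(j < J) r ^+ j)).
  apply: ler_sum => j _; rewrite normcX; apply: lerXn2r => //.
  by rewrite nnegrE normc_ge0.
have y1 : 0 < 1 - r by rewrite subr_gt0.
rewrite -[leRHS]mul1r ler_pdivlMr// mulrC.
have /(congr1 -%R) := subrX1 r J; rewrite -mulNr !opprB => <-.
by rewrite gerBl exprn_ge0.
Qed.

Lemma ccvg_geometric (z : R[i]) : normc z < 1 ->
  ccvg (fun J => \sum_(j < J) z ^+ j) (1 - z)^-1.
Proof.
move=> z1.
have y0 : 1 - z != 0.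
  rewrite -normc_neq0 gt_eqF// (lt_le_trans _ (normc_1sub_ge z))// subr_gt0//.
have E J : \sum_(j < J) z ^+ j = (1 - z ^+ J) * (1 - z)^-1.
  have /(congr1 -%R) := subrX1 z J; rewrite -mulNr !opprB => ->.
  by rewrite mulrAC mulfV// mul1r.
under eq_fun do rewrite E.
rewrite [X in ccvg _ X](_ : _ = (1 - 0) * (1 - z)^-1); last by rewrite subr0 mul1r.
apply: ccvgM; last exact: ccvg_cst.
apply: ccvgB; first exact: ccvg_cst.
apply/ccvg_dist; under eq_fun do rewrite subr0 normcX.
by apply: cvg_expr; rewrite ger0_norm ?normc_ge0.
Qed.

Lemma normc_subrX_le (a b : R[i]) k : normc a <= 1 -> normc b <= 1 ->
  normc (a ^+ k - b ^+ k) <= k%:R * normc (a - b).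
Proof.
move=> a1 b1; rewrite subrXX Normc.normcM mulrC ler_wpM2r ?normc_ge0//.
apply: le_trans (normc_sum_le _ _ _) _.
apply: (@le_trans _ _ (\sum_(i < k) 1)); last by rewrite sumr_const card_ord.
apply: ler_sum => i _; rewrite Normc.normcM !normcX.
by rewrite mulr_ile1 ?exprn_ge0 ?normc_ge0 ?exprn_ile1 ?normc_ge0.
Qed.

End GeometricSums.

(** * The Hardy projection and the multipliers of the Hardy space *)

Section Hardy.
Variable R : realType.
Notation normc := Normc.normc.
Local Notation arc := (@arclength R).
Local Notation L2c := (L2 (@arclength R)).
Implicit Types (f g : L2c) (k l : circle R -> R[i]).

Lemma hardy_zpow (n : nat) : hardy (zpow R n).
Proof.
apply: subset_closure; exists n.+1; exists (fun j : 'I_n.+1 => (j == ord_max)%:R).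
rewrite big_ord_recr /= eqxx scale1r big1 ?add0r// => i _.
by rewrite (_ : _ == _ = false) ?scale0r//; apply/negbTE; rewrite -val_eqE/= ltn_eqF.
Qed.

Lemma hardy_sequence f : hardy f -> exists g : nat -> L2c,
  (forall N, exists n, exists c : 'I_n -> R[i], g N = \sum_(j < n) c j *: zpow R j%:Z) /\
  cvgL2 g f.
Proof.
move=> hf.
have H N : exists g : L2c, (exists n, exists c : 'I_n -> R[i],
     g = \sum_(j < n) c j *: zpow R j%:Z) /\ normsq (g - f) < N.+1%:R^-1.
  pose e : R := Num.sqrt N.+1%:R^-1.
  have e0 : 0 < e by rewrite sqrtr_gt0 invr_gt0.
  have eC : 0 < e%:C by rewrite ltcR.
  have [g [[n [c gE]] fg]] := hf (ball (f : L2c) e%:C) (nbhsx_ballx _ _ eC).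
  move: fg; rewrite -ball_normE /ball_ /= => fg.
  exists g; split; first by exists n, c.
  rewrite -ltcR -L2norm_sqr distrC.
  have -> : N.+1%:R^-1 = e ^+ 2 :> R by rewrite sqr_sqrtr// invr_ge0.
  by rewrite rmorphXn /= !expr2; apply: ltr_pM.
have [g gP] := choice H; exists g; split; first by move=> N; have [] := gP N.
apply: (cvg0_squeeze (b := @harmonic R)); last exact: cvg_harmonic.
by move=> N; rewrite normsq_ge0/= ltW//; have [] := gP N.
Qed.

(** Polynomials are dense in the Hardy space. *)
Lemma hardy_eq d (T : measurableType d) (nu : {measure set T -> \bar R})
  (A B : L2c -> L2 nu) f : blin A -> blin B ->
  (forall n : nat, A (zpow R n%:Z) = B (zpow R n%:Z)) -> hardy f -> A f = B f.
Proof.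
move=> bA bB AB /hardy_sequence[g [gP gf]].
apply: (cvgL2_unique (cvgL2_blin bA gf)).
rewrite (_ : (fun n => A (g n)) = (fun n => B (g n))); first exact: cvgL2_blin.
apply/funext => N; have [n [c ->]] := gP N.
rewrite !blin_sum//; apply: eq_bigr => j _.
by rewrite !blinZ// AB.
Qed.

Section Projection.
Variable P : {linear L2S1 R -> L2S1 R}.
Hypothesis hP : orthoproj_on (@hardy R) P.

Lemma proj_orth f g : hardy g -> L2dot (f - P f) g = 0.
Proof. by move=> hg; have [_ /(_ g hg)] := hP f. Qed.

Lemma proj_hardy f : hardy (P f).
Proof. by have [] := hP f. Qed.

Lemma proj_id f : hardy f -> P f = f.
Proof.
move=> hf; apply/eqP; rewrite eq_sym -subr_eq0; apply/eqP/normsq_eq0.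
rewrite /normsq L2dotDr L2dotNr proj_orth// proj_orth ?subrr//.
exact: proj_hardy.
Qed.

Lemma hardy_proj f : P f = f -> hardy f.
Proof. by move=> <-; exact: proj_hardy. Qed.

Lemma proj_pythagoras f : normsq f = normsq (f - P f) + normsq (P f).
Proof.
by rewrite -pythagoras ?subrK//; apply: proj_orth; exact: proj_hardy.
Qed.

Lemma blin_proj : blin (P : L2c -> L2c).
Proof.
split; first by move=> a f g; rewrite linearP.
by exists 1 => // f; rewrite mul1r [leRHS]proj_pythagoras lerDr normsq_ge0.
Qed.

Lemma cvgL2_proj u f : (forall n, P (u n) = u n) -> cvgL2 u f -> P f = f.
Proof.
move=> Pu uf; apply: (cvgL2_unique (cvgL2_blin blin_proj uf)).
by under eq_fun do rewrite /= Pu.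
Qed.

Lemma proj_zpow (n : nat) : P (zpow R n%:Z) = zpow R n%:Z.
Proof. by apply: proj_id; exact: hardy_zpow. Qed.

(** For polynomials [g] that tend to [P w], the number [|w - g|^2] is at least
    [|w|^2] by orthogonality to the polynomials, and it tends to
    [|w - P w|^2 = |w|^2 - |P w|^2]. *)
Lemma proj_eq0 w : (forall n : nat, L2dot w (zpow R n%:Z) = 0) -> P w = 0.
Proof.
move=> w0; have hPw : hardy (P w) by exact: proj_hardy.
have [g [gP gPw]] := hardy_sequence hPw.
have gw N : L2dot w (g N) = 0.
  have [n [c ->]] := gP N; elim/big_ind : _ => //.
  - by rewrite -(scale0r (0 : L2c)) L2dotZr rmorph0 mul0r.
  - by move=> x y x0 y0; rewrite L2dotDr x0 y0 addr0.
  - by move=> j _; rewrite L2dotZr w0 mulr0.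
have hg N : P (g N) = g N.
  have [n [c ->]] := gP N; rewrite linear_sum; apply: eq_bigr => j _.
  by rewrite linearZ /= proj_zpow.
apply: normsq_eq0.
have h : (fun=> normsq (P w)) @ \oo --> (0 : R).
  apply: (cvg0_squeeze (b := fun N => normsq (g N - P w))) => // N; rewrite normsq_ge0/=.
  have e1 : normsq (w - g N) = normsq w + normsq (g N).
    by rewrite pythagoras ?normsqN// L2dotNr gw oppr0.
  have e2 : normsq (w - g N) = normsq (w - P w) + normsq (P w - g N).
    rewrite -pythagoras ?addrA ?subrK//; apply: proj_orth.
    by apply: hardy_proj; rewrite linearB /= hg [P (P w)]proj_id//; exact: proj_hardy.
  have e3 := proj_pythagoras w; have e4 := normsq_ge0 (g N).
  have e5 : normsq (g N - P w) = normsq (P w - g N) by rewrite -normsqN opprB.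
  by rewrite e5; lra.
exact: (cvg_unique _ (cvg_cst _) h).
Qed.

(** Boundedness together with stability of the Hardy space. Membership is written
    [P f = f] because this is linear in [f]. *)
Definition hardy_mul k := bmul k /\ forall f, P f = f -> P (L2mul k f) = L2mul k f.

Lemma hardy_mul_cst (c : R[i]) : hardy_mul (fun=> c).
Proof.
by split=> [|f Pf]; [exact: bmul_cst|rewrite L2mul_cst linearZ /= Pf].
Qed.

Lemma hardy_mulD k l : hardy_mul k -> hardy_mul l -> hardy_mul (fun v => k v + l v).
Proof.
move=> [bk hk] [bl hl]; split=> [|f Pf]; first exact: bmulD.
by rewrite L2mulD// linearD /= hk// hl.
Qed.

Lemma hardy_mulM k l : hardy_mul k -> hardy_mul l -> hardy_mul (fun v => k v * l v).
Proof.
move=> [bk hk] [bl hl]; split=> [|f Pf]; first exact: bmulM.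
by rewrite L2mulM//; apply: hk; exact: hl.
Qed.

Lemma hardy_mulX k n : hardy_mul k -> hardy_mul (fun v => k v ^+ n).
Proof.
move=> hk; elim: n => [|n IH]; first exact: hardy_mul_cst.
by under eq_fun do rewrite exprS; exact: hardy_mulM.
Qed.

Lemma hardy_mul_sum (I : Type) (r : seq I) (F : I -> circle R -> R[i]) :
  (forall i, hardy_mul (F i)) -> hardy_mul (fun v => \sum_(i <- r) F i v).
Proof.
move=> hF; elim: r => [|i r IH].
  by under eq_fun do rewrite big_nil; exact: hardy_mul_cst.
by under eq_fun do rewrite big_cons; exact: hardy_mulD.
Qed.

Lemma hardy_mul_val : hardy_mul (fun v => val v).
Proof.
have bv : bmul (fun v : circle R => val v) by exact: (bmul_vpow R 1).
split=> // f Pf; have hf := hardy_proj Pf.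
have bL := blin_L2mul arc bv.
apply: (hardy_eq (A := P \o L2mul _) (blin_comp blin_proj bL) bL _ hf) => n /=.
have -> : L2mul (fun v : circle R => val v) (zpow R n) = zpow R n.+1 :> L2c.
  by have := L2mul_vpow R 1 n; rewrite -PoszD add1n.
exact: proj_zpow.
Qed.

(** This is how a given function is shown to be a multiplier: as a bounded
    pointwise limit of polynomials, or of functions already obtained in this
    way. *)
Lemma hardy_mul_lim (u : nat -> circle R -> R[i]) k (C : R) :
  (forall n, hardy_mul (u n)) -> (forall n v, nsq (u n v) <= C) -> bmul k ->
  {ae arc, forall v, ccvg (fun n => u n v) (k v)} -> hardy_mul k.
Proof.
move=> hu uC bk uk; split=> // f Pf.
apply: (cvgL2_proj (u := fun n => L2mul (u n) f)).
  by move=> n; have [_] := hu n; apply.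
by apply: (@L2mul_cvg _ _ _ _ u k f C) => // n; have [[]] := hu n.
Qed.

End Projection.
End Hardy.

(** * The symbol [kappa p] and its poles *)

Section ExponentialLimit.
Variable R : realType.
Notation normc := Normc.normc.

(** With [n = N + 1], compare [a = (1 - w / n)^-1] with [b = e^(w / n)]. Since
    [w] is imaginary, both have modulus at most 1, so that
    [|a ^ n - b ^ n| <= n |a - b|]; and [n (a - 1)] and [n (b - 1)] both tend
    to [w]. *)
Lemma ccvg_exp_inv (w : R[i]) : complex.Re w = 0 ->
  ccvg (fun N => ((1 - N.+1%:R^-1 * w)^-1) ^+ N.+1) (cexp w).
Proof.
move=> w0.
pose a N : R[i] := (1 - N.+1%:R^-1 * w)^-1.
pose b N : R[i] := cexp (N.+1%:R^-1 * w).
have N0 N : (N.+1%:R : R[i]) != 0 by rewrite pnatr_eq0.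
have ReNw N : complex.Re (N.+1%:R^-1 * w) = 0.
  by rewrite real_complex_nat -fmorphV complex_ReZ w0 mulr0.
have b1 N : normc (b N) <= 1 by rewrite normc_cexp ReNw expR0.
have d1 N : 1 <= normc (1 - N.+1%:R^-1 * w).
  apply: le_trans (ler_Re_normc _).
  by rewrite raddfB/= ReNw subr0 normr1.
have d0 N : 1 - N.+1%:R^-1 * w != 0.
  by rewrite -normc_neq0 gt_eqF// (lt_le_trans ltr01)// d1.
have a1 N : normc (a N) <= 1.
  by rewrite Normc.normcV invf_le1 ?d1// (lt_le_trans ltr01)// d1.
have bE N : b N ^+ N.+1 = cexp w by rewrite -cexpMn mulrA mulfV// mul1r.
have cN : ccvg (fun N => (N.+1%:R^-1 : R[i])) 0.
  have := ccvg_real (@cvg_harmonic R); congr ccvg; apply/funext => K /=.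
  by rewrite [in RHS]real_complex_nat fmorphV.
have ca : ccvg (fun N => N.+1%:R * (a N - 1)) w.
  have E N : N.+1%:R * (a N - 1) = w * (1 - N.+1%:R^-1 * w)^-1.
    apply: (mulIf (d0 N)); rewrite mulfVK ?d0// -mulrA mulrBl mulVf ?d0//.
    by rewrite mul1r opprB addrCA subrr addr0 mulrA mulfV ?mul1r.
  under eq_fun do rewrite E.
  rewrite [X in ccvg _ X](_ : _ = w * (1 - 0 * w)^-1); last first.
    by rewrite mul0r subr0 invr1 mulr1.
  apply: ccvgM; first exact: ccvg_cst.
  apply: ccvgV; first by rewrite mul0r subr0 oner_eq0.
  apply: ccvgB; first exact: ccvg_cst.
  by apply: ccvgM; last exact: ccvg_cst.
have cab : (fun N => normc (N.+1%:R * (a N - b N))) @ \oo --> (0 : R).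
  have := ccvgB ca (ccvg_cexp_derivative w); rewrite subrr => /ccvg_normc.
  rewrite Normc.normc0; apply: cvg_trans; apply: near_eq_cvg; apply: nearW => N.
  by congr normc; rewrite /b; ring.
apply/ccvg_dist; apply: (cvg0_squeeze _ cab) => N.
rewrite normc_ge0/= -(bE N) (le_trans (normc_subrX_le _ (a1 N) (b1 N)))//.
rewrite Normc.normcM (_ : normc N.+1%:R = N.+1%:R)//.
by rewrite real_complex_nat /= expr0n/= addr0 sqrtr_sqr ger0_norm.
Qed.

End ExponentialLimit.

Section Symbol.
Variables (R : realType) (p : nat).
Hypothesis p_gt1 : (1 < p)%N.
Notation normc := Normc.normc.
Local Notation arc := (@arclength R).
Local Notation L := (ln (p%:R : R)).

Definition cayley (v : circle R) : R[i] := (val v + 1) / (val v - 1).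

Lemma Re_cayley v : complex.Re (cayley v) = 0.
Proof.
rewrite /cayley complex_ReM complex_ReV complex_ImV.
have := nsq_circle v; rewrite /nsq; case: (val v) => x y /= h.
rewrite !subr0 !addr0 mulrN opprK !mulrA -mulrDl.
have h2 : x ^+ 2 = 1 - y ^+ 2 by rewrite -h addrK.
have -> : (x + 1) * (x - 1) + y * y = 0 by ring: h2.
by rewrite mul0r.
Qed.

Lemma Cmeas_cayley : Cmeas cayley.
Proof.
apply: CmeasM; first by apply: CmeasD; [exact: Cmeas_val|exact: Cmeas_cst].
by apply: CmeasV; apply: CmeasB; [exact: Cmeas_val|exact: Cmeas_cst].
Qed.

(** The singular inner function [p ^ ((v + 1) / (v - 1))]. *)
Definition inner_fun (v : circle R) : R[i] := cexp (L%:C * cayley v).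

Lemma nsq_inner_fun v : nsq (inner_fun v) = 1.
Proof.
by rewrite /nsq -normc_sqr normc_cexp complex_ReZ Re_cayley mulr0 expR0 expr1n.
Qed.

Lemma Cmeas_inner_fun : Cmeas inner_fun.
Proof.
by apply: Cmeas_cexp; apply: CmeasM; [exact: Cmeas_cst|exact: Cmeas_cayley].
Qed.

Lemma bmul_inner_fun : bmul inner_fun.
Proof. by split; [exact: Cmeas_inner_fun|exists 1 => v; rewrite nsq_inner_fun]. Qed.

Section Hmul.
Variable P : {linear L2S1 R -> L2S1 R}.
Hypothesis hP : orthoproj_on (@hardy R) P.

Lemma nsq_le (z : R[i]) (r : R) : normc z <= r -> nsq z <= r ^+ 2.
Proof.
move=> zr; rewrite /nsq -normc_sqr; apply: lerXn2r => //; rewrite nnegrE ?normc_ge0//.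
exact: le_trans (normc_ge0 z) zr.
Qed.

Lemma bmul_geometric (rho : R[i]) : normc rho < 1 ->
  bmul (fun v : circle R => (1 - rho * val v)^-1).
Proof.
move=> r1; split.
  apply: CmeasV; apply: CmeasB; first exact: Cmeas_cst.
  by apply: CmeasM; [exact: Cmeas_cst|exact: Cmeas_val].
have y0 : 0 < 1 - normc rho by rewrite subr_gt0.
exists ((1 - normc rho)^-1 ^+ 2) => v; apply: nsq_le.
have := normc_1sub_ge (rho * val v); rewrite Normc.normcM normc_circle mulr1 => h.
by rewrite Normc.normcV lef_pV2// posrE (lt_le_trans y0).
Qed.

Lemma hardy_mul_geometric (rho : R[i]) : normc rho < 1 ->
  hardy_mul P (fun v : circle R => (1 - rho * val v)^-1).
Proof.
move=> r1.
have nv (v : circle R) : normc (rho * val v) = normc rho by rewrite Normc.normcM normc_circle mulr1.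
apply: (hardy_mul_lim hP (u := fun J v => \sum_(j < J) (rho * val v) ^+ j)
  (C := (1 - normc rho)^-1 ^+ 2)).
- move=> J; under eq_fun do rewrite -(big_mkord xpredT (fun j => (rho * val _) ^+ j)).
  apply: hardy_mul_sum => j; apply: hardy_mulX.
  by apply: hardy_mulM; [exact: hardy_mul_cst|exact: hardy_mul_val].
- by move=> J v; apply: nsq_le; apply: normc_geometric_le; rewrite ?nv.
- exact: bmul_geometric.
- by apply: aeW => v; apply: ccvg_geometric; rewrite nv.
Qed.

(** It is the limit of [m ^ n] with [n = N + 1], where
    [m = (1 - (log p / n) cayley v)^-1] has modulus at most 1 on the circle and, as a Moebius function of [v], has
    its pole outside the closed disk: a multiplier, by the geometric series. *)
Lemma hardy_mul_inner_fun : hardy_mul P inner_fun.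
Proof.
have L0 : 0 < L by exact: logp_gt0.
pose lam N : R := N.+1%:R^-1 * L.
have lam0 N : 0 < lam N by rewrite mulr_gt0// invr_gt0.
have lam1 N : (1 + (lam N)%:C : R[i]) != 0.
  by rewrite -(rmorph1 (real_complex R)) -rmorphD fmorph_eq0 gt_eqF// addr_gt0.
pose rho N : R[i] := (1 - (lam N)%:C) / (1 + (lam N)%:C).
pose m N (v : circle R) : R[i] := (1 - val v) / (1 + (lam N)%:C) * (1 - rho N * val v)^-1.
have rho1 N : normc (rho N) < 1.
  have -> : rho N = ((1 - lam N) / (1 + lam N))%:C.
    by rewrite rmorphM fmorphV !rmorphD rmorphN rmorph1.
  have h : 0 < 1 + lam N by rewrite addr_gt0.
  rewrite /= expr0n/= addr0 sqrtr_sqr normrM normfV (gtr0_norm h) ltr_pdivrMr// mul1r.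
  by rewrite ltr_norml; have := lam0 N; lra.
have hm N : hardy_mul P (m N).
  apply: hardy_mulM; last exact: hardy_mul_geometric.
  apply: hardy_mulM; last exact: hardy_mul_cst.
  rewrite (_ : (fun _ => _) = (fun v => 1 + (-1) * val v)); last first.
    by apply/funext => v; rewrite mulN1r.
  apply: hardy_mulD; first exact: hardy_mul_cst.
  by apply: hardy_mulM; [exact: hardy_mul_cst|exact: hardy_mul_val].
have mE N v : val v != 1 -> m N v = (1 - N.+1%:R^-1 * (L%:C * cayley v))^-1.
  move=> v1; have v1' : val v - 1 != 0 by rewrite subr_eq0.
  have rv : 1 - rho N * val v != 0.
    rewrite -normc_neq0 gt_eqF// (lt_le_trans _ (normc_1sub_ge _))//.
    by rewrite Normc.normcM normc_circle mulr1 subr_gt0.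
  have -> : N.+1%:R^-1 * (L%:C * cayley v) = (lam N)%:C * cayley v.
    by rewrite /lam rmorphM fmorphV rmorph_nat mulrA.
  have D : 1 - (lam N)%:C * cayley v = (1 - rho N * val v) * (1 + (lam N)%:C) / (1 - val v).
    rewrite /cayley /rho; field; rewrite v1' lam1 /=.
    by rewrite -opprB oppr_eq0 v1'.
  by rewrite D !invfM invrK /m; ring.
apply: (hardy_mul_lim hP (u := fun N v => m N v ^+ N.+1) (C := 1)).
- by move=> N; exact: hardy_mulX.
- move=> N v; have [v1|v1] := eqVneq (val v) 1.
    by rewrite /m v1 subrr !mul0r expr0n /nsq /= !expr0n addr0.
  rewrite nsqX exprn_ile1 ?nsq_ge0// mE// nsqV invf_le1.
    rewrite /nsq raddfB/= real_complex_nat -fmorphV !complex_ReZ Re_cayley !mulr0 subr0 expr1n.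
    by rewrite lerDl sqr_ge0.
  rewrite /nsq raddfB/= real_complex_nat -fmorphV !complex_ReZ Re_cayley !mulr0 subr0 expr1n.
  by rewrite ltr_pwDl ?sqr_ge0.
- exact: bmul_inner_fun.
- apply: filterS (ae_circle_neq1 R) => v v1; under eq_fun do rewrite mE//.
  by apply: ccvg_exp_inv; rewrite complex_ReZ Re_cayley mulr0.
Qed.

End Hmul.

End Symbol.

Section KappaFormula.
Variables (R : realType) (p : nat).
Hypothesis p_gt1 : (1 < p)%N.
Notation normc := Normc.normc.
Local Notation arc := (@arclength R).
Local Notation L := (ln (p%:R : R)).
Local Notation q := (inner_fun p).
Implicit Types v : circle R.

(** The exponent [z log p] at the point [z = 1/2 + cayley v] where [kappa p]
    evaluates [rho p]. *)
Definition zlogp v : R[i] := L%:C * (2^-1 + cayley v).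

Lemma Re_zlogp v : complex.Re (zlogp v) = L / 2.
Proof.
rewrite /zlogp complex_ReZ; congr (_ * _).
have -> : 2^-1 + cayley v = (2^-1)%:C + cayley v by rewrite fmorphV rmorph_nat.
by rewrite raddfD/= Re_cayley addr0.
Qed.

Lemma Re_zlogp_gt0 v : 0 < complex.Re (zlogp v).
Proof. by rewrite Re_zlogp divr_gt0// logp_gt0. Qed.

Definition inv_1subexp (u : R[i]) : R[i] := (1 - cexp (- u))^-1.

Lemma inv_1subexp_neq0 (u : R[i]) : 0 < complex.Re u -> 1 - cexp (- u) != 0.
Proof. by move=> u0; rewrite subr_eq0 eq_sym cexp_neq1. Qed.

Lemma Cmeas_zlogp : Cmeas zlogp.
Proof.
apply: CmeasM; first exact: Cmeas_cst.
by apply: CmeasD; [exact: Cmeas_cst|exact: Cmeas_cayley].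
Qed.

Lemma bmul_inv_1subexp : bmul (fun v => inv_1subexp (zlogp v)).
Proof.
split.
  apply: CmeasV; apply: CmeasB; first exact: Cmeas_cst.
  by apply: Cmeas_cexp; apply: CmeasN; exact: Cmeas_zlogp.
have y0 : 0 < 1 - expR (- (L / 2)).
  by rewrite subr_gt0 expR_lt1 oppr_lt0 divr_gt0// logp_gt0.
exists ((1 - expR (- (L / 2)))^-1 ^+ 2) => v; apply: nsq_le.
have ReN : complex.Re (- zlogp v) = - (L / 2) by rewrite raddfN/= Re_zlogp.
have := normc_1sub_ge (cexp (- zlogp v)); rewrite normc_cexp ReN => h.
by rewrite /inv_1subexp Normc.normcV lef_pV2// posrE (lt_le_trans y0).
Qed.

Lemma expR_logp : expR (- L) = p%:R^-1.
Proof. by rewrite expRN lnK// posrE ltr0n (ltn_trans _ p_gt1). Qed.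

(** With [a = p^(-1/2)] and [q] the inner function, [p^(z - 1) = a q] and
    [p^(- z) = a / q]; divide [1 - a q] by [1 - a / q]. The first summand is a
    multiplier of the Hardy space, so that all poles come from the second one. *)
Lemma kappaE v : kappa p v =
  - ((expR (- (L / 2)))%:C * q v) + (1 - p%:R^-1) * inv_1subexp (zlogp v).
Proof.
rewrite /kappa /rho /cpow -/(cayley v) /inv_1subexp.
have E1 : (2^-1 + cayley v - 1) * L%:C = - (2^-1 * L%:C) + L%:C * cayley v by field.
have E2 : - (2^-1 + cayley v) * L%:C = - zlogp v by rewrite /zlogp mulNr mulrC.
have E3 : - zlogp v = - (2^-1 * L%:C) - L%:C * cayley v by rewrite /zlogp; ring.
have A : cexp (- (2^-1 * L%:C)) = (expR (- (L / 2)))%:C :> R[i].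
  have -> : - (2^-1 * L%:C) = (- (L / 2))%:C :> R[i].
    by rewrite rmorphN rmorphM fmorphV rmorph_nat mulrC.
  by rewrite /cexp /= /expi cos0 sin0 mulr1.
have A2 : (expR (- (L / 2)))%:C ^+ 2 = p%:R^-1 :> R[i].
  by rewrite -rmorphXn -expRM_natl mulrN mulrC divfK// expR_logp fmorphV rmorph_nat.
have d0 := inv_1subexp_neq0 (Re_zlogp_gt0 v).
rewrite E1 E2 (cexpD (- _)) A -/(q v).
have dE : cexp (- zlogp v) * q v = (expR (- (L / 2)))%:C.
  by rewrite /inner_fun -cexpD E3 subrK A.
have -> : - ((expR (- (L / 2)))%:C * q v) + (1 - p%:R^-1) / (1 - cexp (- zlogp v))
  = (- ((expR (- (L / 2)))%:C * q v) * (1 - cexp (- zlogp v)) + (1 - p%:R^-1)) /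
    (1 - cexp (- zlogp v)).
  by rewrite [RHS]mulrDl mulfK.
congr (_ / _).
rewrite mulrBr mulr1 mulNr opprK -mulrA [q v * _]mulrC dE -expr2 A2.
by ring.
Qed.

Lemma bmul_kappa : bmul (@kappa R p).
Proof.
rewrite (_ : @kappa R p = (fun v => (- (expR (- (L / 2)))%:C) * q v
    + (1 - p%:R^-1) * inv_1subexp (zlogp v))); last first.
  by apply/funext => v; rewrite kappaE mulNr.
apply: bmulD; apply: bmulM; try exact: bmul_cst.
  exact: bmul_inner_fun.
exact: bmul_inv_1subexp.
Qed.

Lemma xp_sub1 (n : int) : zeta_den R p n * (1 - xp R p n) = 4 * 'i * L%:C.
Proof.
rewrite xpE mulrBr mulr1 mulrC divfK ?zeta_den_neq0//.
rewrite /zeta_den !complex_rect rmorphN !rmorphM /= !rmorph_nat rmorph_int.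
by ring.
Qed.

Lemma circle_sub_xp v n : val v - xp R p n != 0.
Proof.
apply/eqP => /eqP; rewrite subr_eq0 => /eqP vx.
by have := nsq_xp_lt1 R p_gt1 n; rewrite -vx nsq_circle ltxx.
Qed.

(** One partial fraction in the variable [v]. It vanishes at infinity, whence
    the subtracted constant: [v = oo] corresponds to [z = 3/2]. *)
Lemma pole_fraction v n : val v != 1 ->
  zeta_coef R p n ^+ 2 / (val v - xp R p n) =
  (zlogp v - 2 * 'i * pi%:C * n%:~R)^-1 -
  ((3 / 2 * L)%:C - 2 * 'i * pi%:C * n%:~R)^-1.
Proof.
move=> v1; have v1' : val v - 1 != 0 by rewrite subr_eq0.
have D0 := zeta_den_neq0 R p_gt1 n; have vx := circle_sub_xp v n.
have i2 : 'i * 'i = -1 :> R[i] by rewrite -expr2 sqrCi.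
have i0 : 'i != 0 :> R[i] by rewrite neq0Ci.
have DE := zeta_denE R p n; have xE := xp_sub1 n.
rewrite zeta_coef_sqr//.
have e2 : (3 / 2 * L)%:C - 2 * 'i * pi%:C * n%:~R = - 'i * zeta_den R p n / 2.
  rewrite -DE !rmorphM fmorphV /= !rmorph_nat.
  by field: i2.
have e1 : zlogp v - 2 * 'i * pi%:C * n%:~R =
   - 'i * zeta_den R p n * (val v - xp R p n) / (2 * (val v - 1)).
  have -> : zlogp v - 2 * 'i * pi%:C * n%:~R =
    ((3 / 2 * L)%:C - 2 * 'i * pi%:C * n%:~R) + L%:C * (cayley v - 1).
    by rewrite /zlogp !rmorphM fmorphV /= !rmorph_nat; field.
  rewrite e2 /cayley.
  have lE : L%:C = - 'i * zeta_den R p n * (1 - xp R p n) / 4.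
    by rewrite -(mulrA (- 'i)) xE; field: i2.
  rewrite lE; move: (val v) (xp R p n) (zeta_den R p n) v1' D0 vx => w x D v1' D0 vx.
  by field.
have lE : L%:C = - 'i * zeta_den R p n * (1 - xp R p n) / 4.
  by rewrite -(mulrA (- 'i)) xE; field: i2.
rewrite e1 e2 lE.
move: (val v) (xp R p n) (zeta_den R p n) v1' D0 vx => w x D v1' D0 vx.
by field: i2; rewrite v1' D0 vx i0.
Qed.

(** The principal parts of [v ^ k / (1 - p^(- z))] at the poles [xp n] with
    [|n| <= N]. *)
Definition pole_sum (k N : nat) v : R[i] := \sum_(j < N.*2.+1)
  zeta_coef R p (j%:Z - N%:Z) ^+ 2 * xp R p (j%:Z - N%:Z) ^+ k /
    (val v - xp R p (j%:Z - N%:Z)).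

Definition inv_1subexp_oo : R[i] := inv_1subexp (3 / 2 * L)%:C.

(** The partial fractions at [z log p] minus those at [(3 / 2) log p]. *)
Lemma ccvg_pole_sum v : val v != 1 ->
  ccvg (fun N => pole_sum 0 N v) (inv_1subexp (zlogp v) - inv_1subexp_oo).
Proof.
move=> v1.
have h1 := partial_fractions (Re_zlogp_gt0 v).
have L0 := logp_gt0 R p_gt1.
have h2 := @partial_fractions R (3 / 2 * L)%:C (mulr_gt0 (divr_gt0 (ltr0Sn _ _) (ltr0Sn _ _)) L0).
have := ccvgB h1 h2; rewrite -/(inv_1subexp _) -/(inv_1subexp (3 / 2 * L)%:C) -/inv_1subexp_oo.
rewrite opprB addrA addrNK.
congr ccvg; apply/funext => N; rewrite -sumrB; apply: eq_bigr => j _.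
by rewrite expr0 mulr1 pole_fraction.
Qed.

Lemma bmul_pole (c : R[i]) n : bmul (fun v => c / (val v - xp R p n)).
Proof.
have x1 : normc (xp R p n) < 1.
  by rewrite -(@ltr_pXn2r _ 2)// ?nnegrE ?normc_ge0// expr1n normc_sqr nsq_xp_lt1.
have y0 : 0 < 1 - normc (xp R p n) by rewrite subr_gt0.
apply: bmulM; first exact: bmul_cst.
split.
  by apply: CmeasV; apply: CmeasB; [exact: Cmeas_val|exact: Cmeas_cst].
exists ((1 - normc (xp R p n))^-1 ^+ 2) => v; apply: nsq_le.
rewrite Normc.normcV lef_pV2// ?posrE.
  rewrite lerBlDr -[X in X <= _](normc_circle v) -{1}[val v](subrK (xp R p n)).
  exact: normc_triangle.
by rewrite lt_def normc_ge0 normc_neq0 circle_sub_xp.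
Qed.

Lemma bmul_pole_sum k N : bmul (pole_sum k N).
Proof.
rewrite /pole_sum; under eq_fun do rewrite -(big_mkord xpredT (fun j =>
  zeta_coef R p (j%:Z - N%:Z) ^+ 2 * xp R p (j%:Z - N%:Z) ^+ k /
    (val _ - xp R p (j%:Z - N%:Z)))).
by apply: bmul_sum => j; exact: bmul_pole.
Qed.

(** The quotient [(v ^ k - x ^ k) / (v - x)] is a polynomial in [v]. *)
Lemma hardy_mul_pole_sum_diff (P : {linear L2S1 R -> L2S1 R}) k N :
  orthoproj_on (@hardy R) P ->
  hardy_mul P (fun v => val v ^+ k * pole_sum 0 N v - pole_sum k N v).
Proof.
move=> hP; rewrite (_ : (fun _ => _) = fun v => \sum_(0 <= j < N.*2.+1)
   zeta_coef R p (j%:Z - N%:Z) ^+ 2 * \sum_(0 <= i < k)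
     val v ^+ (k.-1 - i) * xp R p (j%:Z - N%:Z) ^+ i).
  apply: hardy_mul_sum => j; apply: hardy_mulM; first exact: hardy_mul_cst.
  apply: hardy_mul_sum => i; apply: hardy_mulM; last exact: hardy_mul_cst.
  by apply: hardy_mulX; exact: hardy_mul_val.
apply/funext => v; rewrite /pole_sum mulr_sumr -sumrB big_mkord.
apply: eq_bigr => j _; rewrite expr0 mulr1 big_mkord; move: (j%:Z - N%:Z) => n.
have vx := circle_sub_xp v n.
have := subrXX (val v) (xp R p n) k.
move=> E; set S := \sum_(_ < _) _ in E *.
have -> : S = (val v ^+ k - xp R p n ^+ k) / (val v - xp R p n).
  by rewrite E mulrAC mulfV ?mul1r.
by move: (val v ^+ k) (xp R p n ^+ k) => y z; field.
Qed.

End KappaFormula.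

(** * The Hankel operator *)

Section NegativeShift.
Variables (R : realType) (p : nat).
Hypothesis p_gt1 : (1 < p)%N.
Notation normc := Normc.normc.
Local Notation arc := (@arclength R).
Local Notation l2N := (L2 (@counting_measure.counting nat R)).
Local Notation one := (zpow R 0).
Variable Um : {linear ell2 nat R -> L2S1 R}.
Hypothesis Um_blin : blin (Um : l2N -> L2 arc).
Hypothesis Um_delta : forall n : nat, Um (delta R n) = zpow R (- n%:Z - 1).

(** The sum of the geometric series [x ^ l v ^ (- l - 1)] is [(v - x)^-1]. *)
Lemma Um_zeta n : Um (zeta R p n) =
  L2mul (fun v : circle R => zeta_coef R p n / (val v - xp R p n)) one.
Proof.
pose x := xp R p n; pose b := zeta_coef R p n.
have x1 : normc x < 1.
  by rewrite -(@ltr_pXn2r _ 2)// ?nnegrE ?normc_ge0// expr1n normc_sqr nsq_xp_lt1.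
have xv (v : circle R) : normc (x / val v) = normc x.
  by rewrite Normc.normcM Normc.normcV normc_circle invr1 mulr1.
pose u J (v : circle R) : R[i] := b / val v * \sum_(0 <= l < J) (x / val v) ^+ l.
have bt l : bmul (fun v : circle R => b / val v * (x / val v) ^+ l).
  have bV : bmul (fun v : circle R => (val v)^-1) by exact: (bmul_vpow R (-1)).
  apply: bmulM; first by apply: bmulM => //; exact: bmul_cst.
  by apply: bmulX; apply: bmulM => //; exact: bmul_cst.
have uE J : L2mul (u J) one = \sum_(l <- iota 0 J) (zeta R p n : l2N) l *: Um (delta R l) :> L2 arc.
  have -> : u J = (fun v => \sum_(l <- iota 0 J) b / val v * (x / val v) ^+ l).
    by apply/funext => v; rewrite /u mulr_sumr /index_iota subn0.
  rewrite L2mul_sum//; apply: eq_bigr => l _.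
  rewrite zetaE// Um_delta.
  have -> : (fun v : circle R => b / val v * (x / val v) ^+ l) =
     (fun v => (b * x ^+ l) * vpow (- l%:Z - 1) v).
    apply/funext => v; rewrite /vpow expfzDr ?circle_neq0// -exprnN.
    rewrite (_ : _ ^ (-1) = (val v)^-1) // exprMn exprVn; ring.
  rewrite L2mulM; [|exact: bmul_cst|exact: bmul_vpow].
  by rewrite L2mul_cst L2mul_vpow addr0.
have c1 : cvgL2 (fun J => L2mul (u J) one : L2 arc) (Um (zeta R p n)).
  rewrite (_ : (fun J => _) = fun J =>
    Um (\sum_(l <- iota 0 J) (zeta R p n : l2N) l *: (delta R l : l2N))).
    exact: cvgL2_blin Um_blin (cvgL2_sum_delta_nat _).
  apply/funext => J; rewrite uE (blin_sum _ _ Um_blin).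
  by apply: eq_bigr => l _; rewrite (blinZ _ _ Um_blin).
apply: (cvgL2_unique c1).
have vx (v : circle R) : val v - x = val v * (1 - x / val v).
  by rewrite mulrBr mulr1 mulrCA mulfV ?mulr1// circle_neq0.
apply: (@L2mul_cvg _ _ _ _ _ _ _ (nsq b * (1 - normc x)^-1 ^+ 2)).
- move=> J; have [] // : bmul (u J).
  rewrite /u; under eq_fun do rewrite mulr_sumr; exact: bmul_sum.
- move=> J v; rewrite /u nsqM nsqM nsqV nsq_circle invr1 mulr1 ler_wpM2l ?nsq_ge0//.
  by apply: nsq_le; rewrite big_mkord; apply: normc_geometric_le; rewrite ?xv.
- exact: bmul_pole.
- apply: aeW => v; rewrite vx invfM mulrA; apply: ccvgM; first exact: ccvg_cst.
  under eq_fun do rewrite big_mkord.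
  by apply: ccvg_geometric; rewrite xv.
Qed.

End NegativeShift.

Section Hankel.
Variables (R : realType) (p : nat).
Hypothesis p_gt1 : (1 < p)%N.
Local Notation arc := (@arclength R).
Local Notation l2N := (L2 (@counting_measure.counting nat R)).
Local Notation l2Z := (L2 (@counting_measure.counting int R)).
Local Notation L2c := (L2 (@arclength R)).
Local Notation one := (zpow R 0).
Local Notation logp := (ln (p%:R : R)).

Variable P : {linear L2S1 R -> L2S1 R}.
Hypothesis hP : orthoproj_on (@hardy R) P.
Variable V : {linear ell2 int R -> ell2 nat R}.
Hypothesis bV : blin (V : l2Z -> l2N).
Hypothesis V_delta : forall n : int, V (delta R n) = zeta R p n.
Variable Vadj : ell2 nat R -> ell2 int R.
Hypothesis hVadj : adjoint V Vadj.
Variable Um : {linear ell2 nat R -> L2S1 R}.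
Hypothesis bUm : blin (Um : l2N -> L2c).
Hypothesis Um_delta : forall n : nat, Um (delta R n) = zpow R (- n%:Z - 1).
Variable I : {linear ell2 int R -> ell2 int R}.
Hypothesis bI : blin (I : l2Z -> l2Z).
Hypothesis I_delta : forall n : int, I (delta R n) = delta R (- n).

Variable Up : {linear ell2 nat R -> L2S1 R}.
Hypothesis Up_isometry : isometry (@L2dot _ _ R (@arclength R))
                          (@L2dot _ _ R (@counting_measure.counting nat R)) Up.
Hypothesis Up_delta : forall n : nat, Up (delta R n) = zpow R n%:Z.
Variable Upadj : L2S1 R -> ell2 nat R.
Hypothesis hUpadj : adjoint Up Upadj.

Let mN : forall A : set nat, measurable A. Proof. by []. Qed.
Let mZ : forall A : set int, measurable A. Proof. by []. Qed.

Definition pole_series (k : nat) : L2c := Um (V (I (Vadj (delta R k)))).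

Lemma Vadj_delta k n : (Vadj (delta R k) : l2Z) n = (zeta_coef R p n * xp R p n ^+ k)^*.
Proof.
rewrite -(L2dot_delta mZ) (adjointE hVadj) V_delta L2dotC (L2dot_delta mN).
by rewrite zetaE.
Qed.

(** The coordinates of [V^* delta_k] are the conjugates of those of [zeta n];
    reflecting the index conjugates them back, up to the sign. Mean convergence
    comes from the boundedness of [V]. *)
Lemma cvgL2_pole_series k :
  cvgL2 (fun N => L2mul (pole_sum p k N) one) (- pole_series k).
Proof.
have bA : blin (Um \o V \o I : l2Z -> L2c).
  exact: (blin_comp (blin_comp bUm bV) bI).
have h := cvgL2_blin bA (cvgL2_sum_delta_int (Vadj (delta R k))).
pose F n : L2c := L2mul (fun v : circle R =>
  zeta_coef R p n ^+ 2 * xp R p n ^+ k / (val v - xp R p n)) one.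
have E n : (Um \o V \o I) ((Vadj (delta R k) : l2Z) n *: (delta R n : l2Z)) = - F (- n) :> L2c.
  rewrite (blinZ _ _ bA) /= I_delta V_delta (Um_zeta p_gt1 bUm Um_delta) Vadj_delta.
  rewrite -L2mul_cst -L2mulM; [|exact: bmul_cst|exact: bmul_pole].
  rewrite /F -[- L2mul _ _]scaleN1r -L2mul_cst -L2mulM; [|exact: bmul_cst|exact: bmul_pole].
  apply: (congr1 (fun k => L2mul k one)); apply/funext => v.
  by rewrite zeta_coefN !xpN rmorphM rmorphXn /=; ring.
have S N : L2mul (pole_sum p k N) one = - (Um \o V \o I) (\sum_(j < N.*2.+1)
    (Vadj (delta R k) : l2Z) (j%:Z - N%:Z) *: (delta R (j%:Z - N%:Z) : l2Z)) :> L2c.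
  rewrite L2mul_sum => [|j]; last exact: bmul_pole.
  rewrite (blin_sum _ _ bA); under [in RHS]eq_bigr do rewrite E.
  rewrite sumrN opprK (sum_symmetric F) (sum_symmetric (fun n => F (- n))) oppr0.
  by congr (_ + _); apply: eq_bigr => j _; rewrite opprK addrC.
rewrite /cvgL2; under eq_fun do rewrite S -opprD normsqN.
exact: h.
Qed.

(** The negative powers of [v] are orthogonal to the nonnegative ones: multiply
    both by [v ^ (n + 1)] and use that [Up] is an isometry. *)
Lemma pole_series_orthogonal k : P (pole_series k) = 0.
Proof.
have bPU : blin ((P : L2c -> L2c) \o Um) by exact: blin_comp (blin_proj hP) bUm.
have b0 : blin ((fun=> 0) : l2N -> L2c).
  split; first by move=> a f g; rewrite scaler0 addr0.
  by exists 1 => // f; rewrite normsq0 mul1r normsq_ge0.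
apply: (delta_eq bPU b0) => n /=; rewrite Um_delta.
apply: (proj_eq0 hP) => m.
rewrite -(L2dot_vpow (n%:Z + 1)) !L2mul_vpow.
have -> : n%:Z + 1 + (- n%:Z - 1) = 0 by rewrite -opprD subrr.
have -> : n%:Z + 1 + m%:Z = (n + 1 + m)%N%:Z by rewrite !PoszD.
have iU x y : L2dot (Up x : L2c) (Up y : L2c) = L2dot (x : l2N) (y : l2N) by exact: Up_isometry.
by rewrite -(Up_delta 0) -Up_delta iU (L2dot_delta mN) (deltaE _ mN) addn1 addSn.
Qed.

(** For [k = 0] the series over the poles is [- g], with [g] the
    function [1 / (1 - p^(- z))] minus its value at infinity. For general [k] it
    differs from [- v ^ k g] by an element [D] of the Hardy space, a limit of
    polynomials. So [kappa p v ^ k] is [- (1 - 1 / p)] times the series, which is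
    orthogonal to the Hardy space, up to elements of the Hardy space. *)
Lemma hankel_monomial k :
  let c := (1 - p%:R) / p%:R in
  L2mul (@kappa R p) (zpow R k%:Z) - P (L2mul (@kappa R p) (zpow R k%:Z)) =
  c *: pole_series k.
Proof.
move=> c.
pose g (v : circle R) : R[i] := inv_1subexp (zlogp p v) - inv_1subexp_oo R p.
have bg : bmul g by apply: bmulB; [exact: bmul_inv_1subexp|exact: bmul_cst].
have bk : bmul (@vpow R k) by exact: bmul_vpow.
(* For k = 0 the sums over the poles converge in the mean, and to g at every
   point other than 1. *)
have W0 : L2mul g one = - pole_series 0.
  have ae1 : {ae arc, forall v, forall N, (L2mul (pole_sum p 0 N) one : L2c) v = pole_sum p 0 N v}.
    apply: ae_foralln => N.
    apply: filterS (filterI (L2mulE one (bmul_pole_sum R p_gt1 0 N)) (zpowE R 0)).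
    by move=> v [-> ->]; rewrite /vpow expr0z mulr1.
  have ae2 := cvgL2_ae_unique bg.1 (cvgL2_pole_series 0).
  apply/L2P.
  have {}ae2 : {ae arc, forall v, (- pole_series 0 : L2c) v = g v}.
    apply: ae2; apply: filterS (filterI ae1 (ae_circle_neq1 R)) => v [e1 v1].
    by under eq_fun do rewrite e1; exact: ccvg_pole_sum.
  apply: filterS (filterI (L2mulE one bg) (filterI (zpowE R 0) ae2)) => v [-> [-> ->]].
  by rewrite /vpow expr0z mulr1.
pose D : L2c := L2mul (vpow k) (L2mul g one) + pole_series k.
have PD : P D = D.
  have h0 := cvgL2_blin (blin_L2mul arc bk) (cvgL2_pole_series 0).
  rewrite -W0 in h0.
  have hk : cvgL2 (fun N => - L2mul (pole_sum p k N) one) (pole_series k).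
    rewrite /cvgL2; under eq_fun do rewrite -normsqN opprD opprK.
    by have := cvgL2_pole_series k; rewrite /cvgL2; under eq_fun do rewrite opprK.
  apply: (cvgL2_proj hP _ (cvgL2D h0 hk)) => N.
  rewrite -L2mulM; [|exact: bk|exact: bmul_pole_sum].
  rewrite -L2mulB; [|exact: bmulM bk (bmul_pole_sum R p_gt1 0 N)|exact: bmul_pole_sum].
  have [_] := hardy_mul_pole_sum_diff p_gt1 k N hP; apply.
  exact: (proj_zpow hP 0).
have zk : zpow R k = L2mul (vpow k) one by rewrite L2mul_vpow addr0.
pose X : L2c := L2mul (fun v => - (expR (- (logp / 2)))%:C * inner_fun p v +
   (1 - p%:R^-1) * inv_1subexp_oo R p) (zpow R k).
have PX : P X = X.
  have [] : hardy_mul P (fun v => - (expR (- (logp / 2)))%:C * inner_fun p v +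
      (1 - p%:R^-1) * inv_1subexp_oo R p).
    apply: hardy_mulD; last exact: hardy_mul_cst.
    by apply: hardy_mulM; [exact: hardy_mul_cst|exact: hardy_mul_inner_fun].
  by move=> _; apply; exact: (proj_zpow hP k).
have E : L2mul (@kappa R p) (zpow R k) = X + (1 - p%:R^-1) *: (D - pole_series k).
  have bX : bmul (fun v => - (expR (- (logp / 2)))%:C * inner_fun p v +
      (1 - p%:R^-1) * inv_1subexp_oo R p).
    apply: bmulD; last exact: bmul_cst.
    by apply: bmulM; [exact: bmul_cst|exact: bmul_inner_fun].
  have Eg : L2mul (vpow k) (L2mul g one) = L2mul g (zpow R k).
    rewrite zk -(L2mulM one bk bg) -(L2mulM one bg bk).
    by apply: (congr1 (fun h => L2mul h one)); apply/funext => v; rewrite mulrC.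
  have Ek : @kappa R p = (fun v => (- (expR (- (logp / 2)))%:C * inner_fun p v +
      (1 - p%:R^-1) * inv_1subexp_oo R p) + (1 - p%:R^-1) * g v).
    by apply/funext => v; rewrite (kappaE p_gt1) /g; ring.
  have bc := @bmul_cst _ (circle R) R (1 - p%:R^-1).
  rewrite Ek (L2mulD _ bX (bmulM bc bg)) (L2mulM _ bc bg) L2mul_cst.
  by rewrite /D addrK Eg.
have PW := pole_series_orthogonal k.
have cE : c = - (1 - p%:R^-1).
  rewrite /c; field; rewrite pnatr_eq0 -lt0n.
  by rewrite (ltn_trans _ p_gt1).
rewrite E (blinD _ _ (blin_proj hP)) (blinZ _ _ (blin_proj hP)) (blinB _ _ (blin_proj hP)).
rewrite PX PD PW subr0.
rewrite opprD addrACA subrr add0r -scalerBr addrAC subrr add0r.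
by rewrite cE scaleNr scalerN.
Qed.

Lemma hankel_hardy (f : L2c) : hardy f ->
  L2mul (@kappa R p) f - P (L2mul (@kappa R p) f) =
  ((1 - p%:R) / p%:R) *: Um (V (I (Vadj (Upadj f)))).
Proof.
have bUp := blin_isometry Up_isometry.
have bUpadj : blin (Upadj : L2c -> l2N) by exact: blin_adjoint bUp hUpadj.
have bVadj : blin (Vadj : l2N -> l2Z) by exact: blin_adjoint bV hVadj.
have bK := blin_L2mul arc (bmul_kappa R p_gt1).
have bA : blin (fun f : L2c => L2mul (@kappa R p) f - P (L2mul (@kappa R p) f) : L2c).
  have bPK := blin_comp (blin_proj hP) bK.
  split.
    move=> a f1 f2 /=; rewrite bK.1 linearP /= scalerBr opprD addrACA.
    by [].
  have [_ [M M0 KM]] := bK; exists M => // f1.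
  apply: le_trans (KM f1); rewrite [leRHS](proj_pythagoras hP) lerDl normsq_ge0//.
have bB0 : blin (Um \o V \o I \o Vadj \o Upadj : L2c -> L2c).
  exact: (blin_comp (blin_comp (blin_comp (blin_comp bUm bV) bI) bVadj) bUpadj).
pose c : R[i] := (1 - p%:R) / p%:R.
have bB : blin (fun f : L2c => c *: Um (V (I (Vadj (Upadj f)))) : L2c).
  have := blin_comp (blin_L2mul arc (@bmul_cst _ (circle R) R c)) bB0.
  rewrite (_ : _ \o _ = (fun f : L2c => c *: Um (V (I (Vadj (Upadj f)))) : L2c))//.
  by apply/funext => f1 /=; rewrite L2mul_cst.
apply: (hardy_eq bA bB) => n.
rewrite (hankel_monomial n); congr (_ *: Um (V (I (Vadj _)))).
apply: L2dot_inj => e; rewrite (adjointE hUpadj) -Up_delta.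
by symmetry; exact: Up_isometry.
Qed.

Lemma proj_Up e : P (Up e) = Up e.
Proof.
have bUp : blin (Up : l2N -> L2c) := blin_isometry Up_isometry.
apply: (delta_eq (blin_comp (blin_proj hP) bUp) bUp) => n /=.
by rewrite Up_delta (proj_zpow hP).
Qed.

Lemma Upadj_proj f : Upadj (P f) = Upadj f.
Proof.
apply: L2dot_inj => e; rewrite !(adjointE hUpadj).
apply/eqP; rewrite eq_sym -subr_eq0 -L2dotNl -L2dotDl.
by apply/eqP; apply: (proj_orth hP); apply: (hardy_proj hP); exact: proj_Up.
Qed.

End Hankel.

Theorem lemma3p5 (R : realType) (p : nat) (p_prime : prime p)
  (P : {linear L2S1 R -> L2S1 R}) (hP : orthoproj_on (@hardy R) P)
  (V : {linear ell2 int R -> ell2 nat R}) (V_bounded : bounded_op V)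
  (V_delta : forall n : int, V (delta R n) = zeta R p n)
  (Vadj : ell2 nat R -> ell2 int R) (hVadj : adjoint V Vadj)
  (B : {linear ell2 int R -> ell2 int R}) (B_bounded : bounded_op B)
  (B_positive : positive_op B)
  (B_gram : forall m n : int, inner (B (delta R m)) (B (delta R n)) =
     1 / (2 * 'i * pi%:C * m%:~R - 2 * 'i * pi%:C * n%:~R + (ln p%:R)%:C))
  (Binv : ell2 int R -> ell2 int R)
  (BK : cancel B Binv) (BinvK : cancel Binv B)
  (U : ell2 int R -> ell2 nat R) (U_def : U = V \o Binv)
  (Uadj : ell2 nat R -> ell2 int R) (hUadj : adjoint U Uadj)
  (Up : {linear ell2 nat R -> L2S1 R})
  (Up_isometry : isometry (@L2dot _ _ R (@arclength R))
                          (@L2dot _ _ R (@counting nat R)) Up)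
  (Up_delta : forall n : nat, Up (delta R n) = zpow R n%:Z)
  (Upadj : L2S1 R -> ell2 nat R) (hUpadj : adjoint Up Upadj)
  (Um : {linear ell2 nat R -> L2S1 R})
  (Um_isometry : isometry (@L2dot _ _ R (@arclength R))
                          (@L2dot _ _ R (@counting nat R)) Um)
  (Um_delta : forall n : nat, Um (delta R n) = zpow R (- n%:Z - 1))
  (I : {linear ell2 int R -> ell2 int R}) (I_bounded : bounded_op I)
  (I_delta : forall n : int, I (delta R n) = delta R (- n)) :
  (idfun \- P) \o L2mul (kappa p) \o P =
    ((1 - p%:R) / p%:R) \*: (Um \o V \o I \o Vadj \o Upadj)
  /\
  ((1 - p%:R) / p%:R) \*: (Um \o V \o I \o Vadj \o Upadj) =
    ((1 - p%:R) / p%:R) \*: (Um \o U \o B \o I \o B \o Uadj \o Upadj).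
Proof.
have p1 := prime_gt1 p_prime.
have bV := blin_bounded V_bounded; have bI := blin_bounded I_bounded.
have bUm := blin_isometry Um_isometry.
split; apply/funext => f /=.
  rewrite (hankel_hardy p1 hP bV V_delta hVadj bUm Um_delta bI I_delta
    Up_isometry Up_delta hUpadj); last exact: proj_hardy.
  by rewrite (Upadj_proj hP Up_isometry Up_delta hUpadj).
have UB g : U (B g) = V g by rewrite U_def /= BK.
have BU g : B (Uadj g) = Vadj g.
  apply: L2dot_inj => h; rewrite (positive_selfadjoint B_positive).
  by rewrite (adjointE hUadj) (adjointE hVadj) UB.
by rewrite UB BU.
Qed.
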